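(* Let $\Gamma$ be a countable group, $(X,\mu)$ a standard probability space and $\Gamma\curvearrowright X$ an ergodic probability measure preserving action. If the action is strongly ergodic, then $(\mathrm{Hom}(\mathcal{R}(\Gamma\curvearrowright X),E_0),\sim)$ is trivial, i.e. every homomorphism from $\mathcal{R}(\Gamma\curvearrowright X)$ to $E_0$ is trivial. If the action is not strongly ergodic, then $(\mathrm{Hom}(\mathcal{R}(\Gamma\curvearrowright X),E_0),\sim)$ is not classifiable by countable structures.
   Context: $\mathcal{R}(\Gamma\curvearrowright X)$ is the orbit equivalence relation of the action. $E_0$ is the equivalence relation on $\{0,1\}^{\mathbb{N}}$ given by $\mathbf{x}E_0\mathbf{y}$ iff there is $N\in\mathbb{N}$ with $x_n=y_n$ for all $n\ge N$. A homomorphism from an equivalence relation $E$ on $X$ to $F$ on $Y$ is a Borel map $f:X\to Y$ with $xEy\Rightarrow f(x)Ff(y)$; Borel functions are identified when they agree $\mu$-almost everywhere (so the homomorphism property is required on a conull set). A homomorphism to $E_0$ is trivial if it maps almost every point of $X$ into a single $E_0$-class. $\mathrm{Hom}(E,F)$ is the space of homomorphisms, a standard Borel space with the $\sigma$-algebra inherited from the space of Borel maps $X\to Y$, generated by the functions $f\mapsto\mu(A\cap f^{-1}(B))$, $A\subseteq X$, $B\subseteq Y$ Borel. For $\varphi,\psi\in\mathrm{Hom}(\mathcal{R}(\Gamma\curvearrowright X),E_0)$, $\varphi\sim\psi$ iff $\varphi(x)E_0\psi(x)$ for almost every $x$. A sequence of measurable sets $(A_n)$ is almost invariant if $\lim_n\mu(A_n\Delta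 gA_n)=0$ for all $g\in\Gamma$; it is trivial if $\lim_n\mu(A_n)(1-\mu(A_n))=0$. An ergodic pmp action is strongly ergodic if every almost invariant sequence is trivial. For equivalence relations $E$ on $Y$ and $F$ on $Z$ (standard Borel spaces), $E\le_B F$ means there is a Borel map $f:Y\to Z$ with $xEy\iff f(x)Ff(y)$. A countable signature $L$ is a countable family of function symbols $f_i$ (arity $n_i\ge0$) and relation symbols $R_j$ (arity $m_j\ge1$); $X_L=\prod_i\mathbb{N}^{(\mathbb{N}^{n_i})}\times\prod_j2^{(\mathbb{N}^{m_j})}$ is the Polish space of $L$-structures with universe $\mathbb{N}$, and $\cong_L$ is isomorphism on $X_L$. $E$ is classifiable by countable structures if $E\le_B(\cong_L)$ for some countable signature $L$. *)

(* Defs.v *)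
From HB Require Import structures.
From mathcomp Require Import all_boot all_order all_algebra.
From mathcomp Require Import all_classical all_reals all_analysis.
From mathcomp Require Import measurable_realfun.

Set Implicit Arguments.
Unset Strict Implicit.
Unset Printing Implicit Defensive.
Import Order.TTheory GRing.Theory Num.Theory.
Import numFieldTopology.Exports.
Local Open Scope classical_set_scope.

Definition borel_space (T : ptopologicalType) := g_sigma_algebraType (@open T).

(* A Hausdorff pseudometric space is a metric space. *)
Definition polish (R : realType) (T : completePseudoMetricType R) : Prop :=
  hausdorff_space T /\ (exists2 D : set T, countable D & dense D).

Definition standard_borel (R : realType) (d : measure_display)
    (X : measurableType d) : Prop :=
  exists (T : completePseudoMetricType R) (h : X -> T),
    [/\ polish T, bijective h &
        forall A : set X,
          measurable A <-> exists2 B : set T, <<s @open T >> B & A = h @^-1` B].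

Section Actions.
Context (R : realType) (d : measure_display) (X : measurableType d).
Context (mu : probability X R) (Gamma : groupType) (act : Gamma -> X -> X).

Definition pmp_action : Prop :=
  [/\ forall x, act 1%g x = x,
      forall g h x, act (g * h)%g x = act g (act h x),
      forall g, measurable_fun setT (act g) &
      forall g (A : set X), measurable A -> mu (act g @^-1` A) = mu A].

Definition ergodic : Prop :=
  forall A : set X, measurable A -> (forall g, act g @` A = A) ->
    mu A = 0%E \/ mu A = 1%E.

Definition almost_invariant (A : nat -> set X) : Prop :=
  (forall n, measurable (A n)) /\
  forall g, mu (A n `+` act g @` A n) @[n --> \oo] --> 0%E.

Definition trivial_sequence (A : nat -> set X) : Prop :=
  (mu (A n) * (1 - mu (A n)))%E @[n --> \oo] --> 0%E.

Definition strongly_ergodic : Prop :=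
  ergodic /\ forall A, almost_invariant A -> trivial_sequence A.

Definition orbit_rel (x y : X) : Prop := exists g, y = act g x.

End Actions.

Definition E0_space := borel_space cantor_space.

Definition E0 (x y : E0_space) : Prop :=
  exists N : nat, forall n, (N <= n)%N -> x n = y n.

Section Homomorphisms.
Context (R : realType) (d : measure_display) (X : measurableType d).
Context (mu : probability X R).

Section General.
Context (d' : measure_display) (Y : measurableType d').

(* The sigma-algebra on Borel maps modulo mu-a.e. equality making every
   f |-> mu (A `&` f @^-1` B) measurable; elements of the quotient act through
   a representative, whose choice does not change these values. *)
Definition mfun_generators : set (set {mfun_ mu, X >-> Y}) :=
  [set S | exists (A : set X) (B : set Y), [/\ measurable A, measurable B &
     preimage_set_system setT
       (fun f : {mfun_ mu, X >-> Y} => mu (A `&` f @^-1` B))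
       (measurable : set (set (\bar R))) S]].

HB.instance Definition _ := isPointed.Build {mfun_ mu, X >-> Y}
  (\pi_({mfun_ mu, X >-> Y}) (cst point : {mfun X >-> Y}))%qT.

Definition mfun_space := g_sigma_algebraType mfun_generators.

Definition homomorphism (E : X -> X -> Prop) (F : Y -> Y -> Prop)
    (f : X -> Y) : Prop :=
  exists X0 : set X, [/\ measurable X0, mu (~` X0) = 0%E &
    forall x y, X0 x -> X0 y -> E x y -> F (f x) (f y)].

Definition hom_set (E : X -> X -> Prop) (F : Y -> Y -> Prop) :
    set {mfun_ mu, X >-> Y} :=
  [set f | homomorphism E F f].

End General.

Section HomE0.
Context (E : X -> X -> Prop).

Definition Hom_E0 : Type := set_type (hom_set E E0).

(* Measurable types are pointed: the base point is the class of a constant map. *)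
Lemma hom_set_cst : hom_set E E0 point.
Proof.
have /eqmodP/asboolP[N [mN N0 sN]] :
    repr (point : {mfun_ mu, X >-> E0_space})
      = (cst point : {mfun X >-> E0_space})
    %[mod {mfun_ mu, X >-> E0_space}]%qT.
  by rewrite reprK.
exists (~` N); split; [exact: measurableC|by rewrite setCK|].
have reprN x : (~` N) x ->
    (point : {mfun_ mu, X >-> E0_space}) x = point.
  by move=> Nx; apply: contrapT => xN; apply/Nx/sN => /(_ I).
by move=> x y /reprN -> /reprN -> _; exists 0%N.
Qed.

HB.instance Definition _ := gen_eqMixin Hom_E0.
HB.instance Definition _ := gen_choiceMixin Hom_E0.
HB.instance Definition _ := isPointed.Build Hom_E0
  (exist _ (point : {mfun_ mu, X >-> E0_space}) (mem_set hom_set_cst)).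

Definition hom_val (phi : Hom_E0) : {mfun_ mu, X >-> E0_space} := set_val phi.

(* The sigma-algebra that Hom_E0 inherits from mfun_space as a subset. *)
Definition Hom_E0_space :=
  g_sigma_algebra_preimageType (hom_val : Hom_E0 -> mfun_space E0_space).

Definition trivial_hom (phi : Hom_E0) : Prop :=
  exists y : E0_space, {ae mu, forall x, E0 (hom_val phi x) y}.

Definition hom_equiv (phi psi : Hom_E0_space) : Prop :=
  {ae mu, forall x, E0 (hom_val phi x) (hom_val psi x)}.

End HomE0.

End Homomorphisms.

Definition borel_reducible (d1 d2 : measure_display)
    (Y : measurableType d1) (Z : measurableType d2)
    (E : Y -> Y -> Prop) (F : Z -> Z -> Prop) : Prop :=
  exists f : Y -> Z,
    measurable_fun setT f /\ forall x y, E x y <-> F (f x) (f y).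

Record signature := Signature {
  fun_symbol : countType;
  rel_symbol : countType;
  fun_arity : fun_symbol -> nat;
  rel_arity : rel_symbol -> nat;
  rel_arity_gt0 : forall j, (0 < rel_arity j)%N }.

Section Structures.
Context (L : signature).

Definition fun_interp := prod_topology (fun i : fun_symbol L =>
  {ptws (fun_arity i).-tuple nat -> nat}).

Definition rel_interp := prod_topology (fun j : rel_symbol L =>
  {ptws (rel_arity j).-tuple nat -> bool}).

HB.instance Definition _ := Topological.on fun_interp.
HB.instance Definition _ := Pointed.on fun_interp.
HB.instance Definition _ := Topological.on rel_interp.
HB.instance Definition _ := Pointed.on rel_interp.

Definition structures : Type := (fun_interp * rel_interp)%type.

HB.instance Definition _ := Topological.on structures.
HB.instance Definition _ := Pointed.on structures.

Definition structure_space := borel_space structures.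

Definition structure_iso (M N : structure_space) : Prop :=
  exists g : nat -> nat, [/\ bijective g,
    forall i (a : (fun_arity i).-tuple nat),
      g (M.1 i a) = N.1 i (map_tuple g a) &
    forall j (a : (rel_arity j).-tuple nat),
      M.2 j a = N.2 j (map_tuple g a)].

End Structures.

Definition classifiable_by_countable_structures (d : measure_display)
    (Y : measurableType d) (E : Y -> Y -> Prop) : Prop :=
  exists L : signature, borel_reducible E (@structure_iso L).

(* Main.v *)
Require Import Defs.
From mathcomp Require Import all_boot all_order all_algebra.
From mathcomp Require Import all_classical all_reals all_analysis.
From HB Require Import structures.
From mathcomp Require Import lra.

Set Implicit Arguments.
Unset Strict Implicit.
Unset Printing Implicit Defensive.
Import Order.TTheory GRing.Theory Num.Theory.
Import numFieldNormedType.Exports.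
Local Open Scope classical_set_scope.
Local Open Scope ring_scope.

(** A homomorphism [phi] to E_0 is the same thing as a sequence of sets
    [A_n = {x | phi x n = 1}] such that almost every point of [A_n + g A_n]
    (symmetric difference) leaves these differences eventually.  So a
    homomorphism gives an almost invariant sequence, and a sequence of sets
    whose invariance improves fast enough gives a homomorphism.

    If the action is strongly ergodic, the measures of the [A_n] accumulate
    only at 0 and 1, which singles out one sequence [y] in the Cantor space:
    the sets [N_n] of points where [phi] differs from [y] at [n] have measure
    tending to 0.  The points in infinitely many [N_n] form an invariant set.
    Were it conull, unions of consecutive [N_n], stopped as soon as they fill
    half of the space, would be a non-trivial almost invariant sequence
    ([strongly_ergodic_lim_sup]).

    If the action is not strongly ergodic, take a non-trivial almost invariant
    sequence.  Along an ultrafilter its traces on a set converge, and the limit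
    is an invariant set function dominated by the measure; by ergodicity and a
    Hahn decomposition it is a multiple of the measure, so the sequence becomes
    independent of every given set ([almost_invariant_mixing]).  Cutting
    repeatedly with such sets, one gets for every [k] a finite chain
    [set0 = B k 0 <= B k 1 <= ... <= B k (M k) = setT] of nearly invariant sets
    with steps of measure at most [2^-(k+1)] ([thin_chain_exists]).  Every
    [z : nat -> nat] then defines the homomorphism [phi_z] whose [k]-th bit at
    [u] tells whether [u] is in [B k (z k)].  By Borel-Cantelli, [phi_z] and
    [phi_w] are equivalent as soon as [z k] and [w k] differ by at most one for
    all large [k]; but they are inequivalent when [z k = 0] and [w k = M k] for
    infinitely many [k].

    It remains to see that an assignment of countable structures to the points
    of the Baire space that respects the relation of being eventually at
    distance at most one must be constant up to isomorphism on a comeager set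
    ([generic_ergodicity]).  This is an instance of Hjorth's turbulence
    theorem.  Call [x] and [y] adjacent when they are at distance at most one
    everywhere.  There are only countably many finite tuples, so for a tuple
    [p] some box of adjacent pairs [(x, y)] has, generically, an isomorphism
    from the structure of [x] to the structure of [y] sending [p] to one fixed
    tuple [q].  Two generic points [x] and [x'] that differ by one at one
    coordinate have a common generic neighbour [y], hence their structures are
    isomorphic by a map fixing [p]; and by such moves one can travel from a
    point of the box to any cylinder in the box.  This is enough to play
    back-and-forth between any two generic structures. *)

(** * Baire category for sequences with constrained tails *)

Section TreeCategory.
Context (V : countType) (e : nat -> set V) (e0 : nat -> V).
Hypothesis e0P : forall i, e i (e0 i).

(** One notion covers three spaces, according to the constraint [e]: the Baire
    space, the space of adjacent pairs, and the neighbours of a given point.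
    In the last two cases the topology generated by the boxes is finer than
    pointwise convergence, and a point that violates the constraint infinitely
    often lies in no box. *)
Definition box (c : seq V) : set (nat -> V) :=
  [set z | mkseq z (size c) = c /\ forall i, (size c <= i)%N -> e i (z i)].

Definition nwd (N : set (nat -> V)) : Prop :=
  forall c, exists2 c', box c' `<=` box c & box c' `&` N = set0.

Definition meager (M : set (nat -> V)) : Prop :=
  exists2 N : nat -> set (nat -> V), (forall n, nwd (N n)) & M `<=` \bigcup_n N n.

Lemma box_mkseq z c n : box c z -> (size c <= n)%N -> box (mkseq z n) z.
Proof.
move=> [_ ez] cn; split; first by rewrite size_mkseq.
by move=> i; rewrite size_mkseq => ni; apply: ez; apply: leq_trans ni.
Qed.

(** The constraint of [c] is in force between [size c] and [n], and [z] obeys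
    it, so prolonging the prefix along [z] only shrinks the box. *)
Lemma box_mkseq_sub z c n : box c z -> (size c <= n)%N -> box (mkseq z n) `<=` box c.
Proof.
move=> [zc ez] cn w []; rewrite size_mkseq => /eq_in_map wz ew.
have {}wz i : (i < n)%N -> w i = z i by move=> lin; apply: wz; rewrite mem_iota.
split.
  rewrite -[RHS]zc; apply/eq_in_map => i; rewrite mem_iota add0n /= => ic.
  by apply: wz; apply: leq_trans cn.
move=> i ci; have [/wz ->|/ew //] := ltnP i n; exact: ez.
Qed.

Lemma box_neq0 c : box c !=set0.
Proof.
exists (fun i => if (i < size c)%N then nth (e0 0) c i else e0 i); split.
  apply: (@eq_from_nth _ (e0 0)); first by rewrite size_mkseq.
  by move=> i; rewrite size_mkseq => ic; rewrite nth_mkseq // ic.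
by move=> i ci; rewrite ltnNge ci.
Qed.

(** Boxes form a base of a topology: a prefix of the common point that is
    longer than both words defines a box inside both. *)
Lemma box_nested c d z : box c z -> box d z ->
  exists2 b, box b z & box b `<=` box c `&` box d.
Proof.
move=> cz dz; exists (mkseq z (maxn (size c) (size d))).
  by apply: box_mkseq cz _; rewrite leq_maxl.
rewrite subsetI; split; [apply: box_mkseq_sub cz _ | apply: box_mkseq_sub dz _].
  by rewrite leq_maxl.
by rewrite leq_maxr.
Qed.

Lemma sub_meager A B : A `<=` B -> meager B -> meager A.
Proof. by move=> AB [N nN BN]; exists N => //; apply: subset_trans BN. Qed.

Lemma nwd_meager N : nwd N -> meager N.
Proof. by move=> nN; exists (fun=> N) => // z; exists 0%N. Qed.

Lemma meager_bigcup (T : countType) (M : T -> set (nat -> V)) :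
  (forall t, meager (M t)) -> meager (\bigcup_t M t).
Proof.
move=> mM; have [N NP] := choice (fun t => let: ex_intro2 N a b := mM t in
  ex_intro (fun N => (forall n, nwd (N n)) /\ M t `<=` \bigcup_n N n) N (conj a b)).
exists (fun k => if unpickle k is Some (t, n) then N t n else set0).
  move=> k; case: unpickle => [[t n]|]; first by apply: (NP t).1.
  by move=> c; exists c => //; rewrite setI0.
move=> z [t _ /(NP t).2 [n _ Nz]].
by exists (pickle (t, n)) => //; rewrite pickleK.
Qed.

Lemma meagerU A B : meager A -> meager B -> meager (A `|` B).
Proof.
move=> mA mB; apply: (@sub_meager _ (\bigcup_b (if b then A else B))).
  by move=> z [?|?]; [exists true|exists false].
by apply: meager_bigcup => -[].
Qed.

(** Baire category theorem: the centres of boxes that avoid the nowhere dense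
    sets one after the other, with growing prefixes, converge to a point of
    [box c] that avoids them all. *)
Lemma box_nonmeager c : ~ meager (box c).
Proof.
move=> [N nN cN].
have step (s : nat * ((nat -> V) * nat)) : exists s' : nat * ((nat -> V) * nat),
    box (mkseq s.2.1 s.2.2) s.2.1 ->
    [/\ s'.1 = s.1.+1, (s.2.2 < s'.2.2)%N, box (mkseq s'.2.1 s'.2.2) s'.2.1,
        box (mkseq s'.2.1 s'.2.2) `<=` box (mkseq s.2.1 s.2.2) &
        box (mkseq s'.2.1 s'.2.2) `&` N s.1 = set0].
  case: s => k [z n] /=; have [d dz dN] := nN k (mkseq z n).
  have [w dw] := box_neq0 d.
  exists (k.+1, (w, maxn n.+1 (size d))) => zz /=.
  have sub : box (mkseq w (maxn n.+1 (size d))) `<=` box d.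
    by apply: box_mkseq_sub => //; rewrite leq_maxr.
  split=> //; first by rewrite leq_maxl.
  - by apply: box_mkseq dw _; rewrite leq_maxr.
  - exact: subset_trans dz.
  - by rewrite -subset0 -dN; apply: setSI.
have {step}[F FP] := choice step.
have [z0 cz0] := box_neq0 c.
pose s k := iter k F (0%N, (z0, size c)).
have sbox k : box (mkseq (s k).2.1 (s k).2.2) (s k).2.1.
  elim: k => [|k IH]; first by apply: box_mkseq cz0 _.
  by rewrite /s iterS; have [] := FP _ IH.
have s1 k : (s k).1 = k.
  by elim: k => // k IH; rewrite {1}/s iterS; have [-> _ _ _ _] := FP _ (sbox k); rewrite IH.
have slt k : ((s k).2.2 < (s k.+1).2.2)%N by have [] := FP _ (sbox k).
have sge k : (k <= (s k).2.2)%N.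
  by elim: k => // k IH; apply: leq_ltn_trans (slt k).
have ssub k l : (k <= l)%N ->
    box (mkseq (s l).2.1 (s l).2.2) `<=` box (mkseq (s k).2.1 (s k).2.2).
  elim: l => [|l IH]; first by rewrite leqn0 => /eqP ->.
  rewrite leq_eqVlt => /orP[/eqP ->//|]; rewrite ltnS => /IH; apply: subset_trans.
  by have [] := FP _ (sbox l).
pose z i := (s i.+1).2.1 i.
have agree k l i : (k <= l)%N -> (i < (s k).2.2)%N -> (s l).2.1 i = (s k).2.1 i.
  move=> kl ik; have := ssub _ _ kl _ (sbox l); rewrite /box /= size_mkseq.
  by move=> [/eq_in_map + _]; apply; rewrite mem_iota.
have zE k i : (i < (s k).2.2)%N -> z i = (s k).2.1 i.
  move=> ik; have ii : (i < (s i.+1).2.2)%N by apply: sge.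
  rewrite /z; have [/agree|/ltnW/agree] := leqP k i.+1; first exact.
  by move=> <-.
have zbox k : box (mkseq (s k).2.1 (s k).2.2) z.
  split; rewrite size_mkseq.
    by apply/eq_in_map => i; rewrite mem_iota => ik; apply: zE.
  move=> i ki; have := ssub k (maxn k i.+1) (leq_maxl _ _) _ (sbox _).
  rewrite /box/= size_mkseq => -[_ /(_ i ki)]; rewrite -zE //.
  by apply: leq_trans (sge _); rewrite leq_maxr.
have : box c z by apply: (box_mkseq_sub cz0 (leqnn _)); apply: (zbox 0%N).
move=> /cN [k _ Nz]; have [_ _ _ _ /seteqP[+ _]] := FP _ (sbox k).
by move=> /(_ z); apply; split; [apply: (zbox k.+1) | rewrite s1].
Qed.

Definition everywhere_nonmeager (A : set (nat -> V)) (c : seq V) : Prop :=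
  forall c', box c' `<=` box c -> ~ meager (A `&` box c').

(** Otherwise the boxes in which [A] is meager would be dense below [c], and as
    they are countably many, [A] would be meager in [c]. *)
Lemma nonmeager_localize A c : ~ meager (A `&` box c) ->
  exists2 c', box c' `<=` box c & everywhere_nonmeager A c'.
Proof.
move=> mA; apply: contrapT => noc; apply: mA.
pose W : set (nat -> V) := \bigcup_(d in [set d | meager (A `&` box d)]) box d.
apply: (@sub_meager _ ((box c `\` W) `|`
    \bigcup_d (A `&` (if `[< meager (A `&` box d) >] then box d else set0)))).
  move=> z [Az cz]; have [[d md dz]|nW] := pselect (W z); last by left.
  by right; exists d => //; rewrite asboolT.
apply: meagerU; last first.
  apply: meager_bigcup => d; case: asboolP => // _; rewrite setI0.
  by apply: nwd_meager => b; exists b => //; rewrite setI0.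
apply: nwd_meager => d; have [/eqP dc0|/set0P[z [dz cz]]] := boolP (box d `&` box c == set0).
  by exists d => //; rewrite setDE setIA dc0 set0I.
have [b bz] := box_nested dz cz; rewrite subsetI => -[bd bc].
have /existsNP[b' /not_implyP[b'b /contrapT mb']] :
    ~ everywhere_nonmeager A b by move=> Ab; apply: noc; exists b.
exists b'; first exact: subset_trans bd.
by apply/seteqP; split=> // w [b'w [_]]; apply; exists b'.
Qed.

(** Equivalent to the usual Baire property because there are countably many
    boxes; this form makes the closure properties and the passage to
    generic continuity immediate. *)
Definition baire_property (A : set (nat -> V)) : Prop :=
  forall c, exists2 c', box c' `<=` box c &
    meager (A `&` box c') \/ meager (box c' `\` A).

Lemma baire_property_setC A : baire_property A -> baire_property (~` A).
Proof.
move=> bA c; have [c' c'c mA] := bA c; exists c' => //; rewrite setDE setCK.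
by rewrite (setIC (~` _)) -setDE (setIC (box c')); case: mA; [right|left].
Qed.

Lemma baire_property_bigcup (A : nat -> set (nat -> V)) :
  (forall n, baire_property (A n)) -> baire_property (\bigcup_n A n).
Proof.
move=> bA c; have [[c' [c'c mA]]|noc] := pselect
    (exists c', box c' `<=` box c /\ exists n, meager (box c' `\` A n)).
  exists c' => //; right; case: mA => n; apply: sub_meager => z [? nA].
  by split=> // Az; apply: nA; exists n.
exists c => //; left; rewrite setI_bigcupl; apply: meager_bigcup => n.
apply: contrapT => /nonmeager_localize[c' c'c An].
have [b bc' [mb|mb]] := bA n c'; first exact: (An b).
by apply: noc; exists b; split; [apply: subset_trans c'c | exists n].
Qed.

(** Outside a meager set, membership in [A] is decided by a box around the
    point, relative to the complement of that set. *)
Lemma baire_property_continuous A : baire_property A ->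
  exists2 M, meager M & forall z, ~ M z -> exists2 c, box c z &
    (forall w, box c w -> ~ M w -> A w) \/ (forall w, box c w -> ~ M w -> ~ A w).
Proof.
move=> bA.
pose dec d := `[< meager (A `&` box d) \/ meager (box d `\` A) >].
pose W : set (nat -> V) := \bigcup_(d in [set d | dec d]) box d.
pose M0 d := if `[< meager (A `&` box d) >] then A `&` box d else
  if `[< meager (box d `\` A) >] then box d `\` A else set0.
exists (~` W `|` \bigcup_d M0 d).
  apply: meagerU.
    apply: nwd_meager => c; have [c' c'c /asboolP dc'] := bA c.
    by exists c' => //; apply/seteqP; split => // z [c'z]; apply; exists c'.
  apply: meager_bigcup => d; rewrite /M0; case: asboolP => // _.
  case: asboolP => // _; by apply: nwd_meager => a; exists a => //; rewrite setI0.
move=> z /not_orP[/contrapT[c /asboolP cdec cz] _]; exists c => //.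
have [mc|nmc] := pselect (meager (A `&` box c)); [right|left] => w cw.
  move=> /not_orP[_ +] Aw; apply; exists c => //; rewrite /M0 asboolT //.
move=> /not_orP[_ +]; apply: contra_notP => nAw; exists c => //.
have mc : meager (box c `\` A) by case: cdec.
by rewrite /M0 asboolF // asboolT //; split.
Qed.

(** Seen as forcing, [everywhere_nonmeager A c] says that [c] does not exclude
    [A] anywhere below it; the lemma is the forcing clause for a countable
    disjunction. *)
Lemma forced_bigcup_meager A (B : nat -> set (nat -> V)) : A `<=` \bigcup_n B n ->
  meager [set z | (exists2 c, box c z & everywhere_nonmeager A c) /\
    forall n, ~ exists2 c, box c z & everywhere_nonmeager (B n) c].
Proof.
move=> AB; apply: nwd_meager => d; have [[z [dz [[c cz Ac] _]]]|nod] := pselect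
  (exists z, box d z /\ ((exists2 c, box c z & everywhere_nonmeager A c) /\
    forall n, ~ exists2 c, box c z & everywhere_nonmeager (B n) c)); last first.
  by exists d => //; rewrite -subset0 => z [dz ?]; apply: nod; exists z.
have [b bz] := box_nested cz dz; rewrite subsetI => -[bc bd].
have [n /nonmeager_localize[b' b'b Bb']] : exists n, ~ meager (B n `&` box b).
  apply: contrapT => /forallNP nB; apply: (Ac b bc).
  apply: (@sub_meager _ (\bigcup_n (B n `&` box b))).
    by move=> w [/AB [n _ Bw] bw]; exists n.
  by apply: meager_bigcup => n; apply: contrapT; apply: nB.
exists b'; first exact: subset_trans bd.
by rewrite -subset0 => w [b'w [_ /(_ n)]]; apply; exists b'.
Qed.

End TreeCategory.

(** * Isomorphism and back-and-forth systems *)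
Section BackAndForth.
Context (K : Type).

Implicit Types (M N : K -> seq nat -> Prop) (p q r : seq nat).

(** A countable structure is presented by relations indexed by [K] on words of
    any length, so that operations can be coded by their graphs. *)
Definition iso M N (g : nat -> nat) : Prop :=
  bijective g /\ forall k s, M k s <-> N k (map g s).

Definition iso_tuples M N p q : Prop := exists2 g, iso M N g & map g p = q.

Definition partial_iso M N p q : Prop :=
  [/\ size p = size q,
      forall i j, (i < size p)%N -> (j < size p)%N ->
        (nth 0%N p i = nth 0%N p j <-> nth 0%N q i = nth 0%N q j) &
      forall k I, all (fun i => i < size p)%N I ->
        (M k (map (nth 0%N p) I) <-> N k (map (nth 0%N q) I))].

Definition back_and_forth M N (S : seq nat -> seq nat -> Prop) : Prop :=
  forall p q, S p q -> [/\ partial_iso M N p q,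
    forall m, exists n, S (rcons p m) (rcons q n) &
    forall n, exists m, S (rcons p m) (rcons q n)].

Lemma iso_tuples_sym M N p q : iso_tuples M N p q -> iso_tuples N M q p.
Proof.
move=> [g [[h gK hK] gP] <-]; exists h; last by rewrite mapK.
by split; [exists g | move=> k s; rewrite gP mapK].
Qed.

Lemma iso_tuples_trans M N O p q r :
  iso_tuples M N p q -> iso_tuples N O q r -> iso_tuples M O p r.
Proof.
move=> [g [bg gP] <-] [h [bh hP] <-]; exists (h \o g); last by rewrite map_comp.
by split; [apply: bij_comp | move=> k s; rewrite gP hP map_comp].
Qed.

Lemma iso_tuples_refl M p : iso_tuples M M p p.
Proof.
exists id; last by rewrite map_id.
by split; [exists id | move=> k s; rewrite map_id].
Qed.

Lemma iso_tuples_forth M N p q : iso_tuples M N p q ->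
  forall m, exists n, iso_tuples M N (rcons p m) (rcons q n).
Proof.
by move=> [g gi <-] m; exists (g m); exists g => //; rewrite map_rcons.
Qed.

Lemma iso_tuples_back M N p q : iso_tuples M N p q ->
  forall n, exists m, iso_tuples M N (rcons p m) (rcons q n).
Proof.
move=> /iso_tuples_sym/iso_tuples_forth S n; have [m /iso_tuples_sym ?] := S n.
by exists m.
Qed.

Lemma iso_tuples_partial_iso M N p q : iso_tuples M N p q -> partial_iso M N p q.
Proof.
move=> [g [bg gP] <-]; split; first by rewrite size_map.
  move=> i j ip jp; rewrite !(nth_map 0%N) //; split=> [->//|].
  exact: bij_inj.
move=> k I /allP Ip; rewrite gP -map_comp.
suff -> : map (g \o nth 0%N p) I = map (nth 0%N (map g p)) I by [].
by apply/eq_in_map => i /Ip ip; rewrite /= (nth_map 0%N).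
Qed.

(** Stage [n] of the construction puts [n] in the domain and in the range, so
    the union of the tuples is a bijection, enumerated by [P] on one side and
    [Q] on the other, with repetitions that agree. *)
Lemma back_and_forth_iso M N S p q :
  back_and_forth M N S -> S p q -> iso_tuples M N p q.
Proof.
move=> bf Spq.
have step (s : nat * (seq nat * seq nat)) : exists ab : nat * nat, S s.2.1 s.2.2 ->
    S (rcons (rcons s.2.1 s.1) ab.2) (rcons (rcons s.2.2 ab.1) s.1).
  case: s => n [p' q'] /=; have [Spq'|] := pselect (S p' q'); last by exists (0%N, 0%N).
  have [_ /(_ n)[b Sb] _] := bf _ _ Spq'.
  by have [_ _ /(_ n)[a Sa]] := bf _ _ Sb; exists (b, a).
have {step}[F FP] := choice step.
pose next n s := (rcons (rcons s.1 n) (F (n, s)).2, rcons (rcons s.2 (F (n, s)).1) n).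
pose st := fix st n := if n is n'.+1 then next n' (st n') else (p, q).
have Sst n : S (st n).1 (st n).2 by elim: n => // n IH; apply: (FP (n, st n)).
have psz n : size (st n).2 = size (st n).1 by have [[]] := bf _ _ (Sst n).
have szS n : size (st n.+1).1 = (size (st n).1).+2 by rewrite /= !size_rcons.
have szge n : (n <= size (st n).1)%N.
  by elim: n => // n IH; rewrite szS; apply: ltn_trans (ltnSn _).
have szmono m n : (m <= n)%N -> (size (st m).1 <= size (st n).1)%N.
  elim: n => [|n IH]; first by rewrite leqn0 => /eqP ->.
  rewrite leq_eqVlt => /orP[/eqP ->//|]; rewrite ltnS => /IH mn.
  by rewrite szS; apply: leq_trans mn (leqW (leqW _)).
have agree m n i : (m <= n)%N -> (i < size (st m).1)%N ->
    nth 0%N (st n).1 i = nth 0%N (st m).1 i /\ nth 0%N (st n).2 i = nth 0%N (st m).2 i.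
  elim: n => [|n IH]; first by rewrite leqn0 => /eqP ->.
  rewrite leq_eqVlt => /orP[/eqP ->//|]; rewrite ltnS => mn im.
  have [<- <-] := IH mn im; have {}im := leq_trans im (szmono _ _ mn).
  by rewrite /= !nth_rcons !size_rcons !psz im (ltn_trans im (ltnSn _)).
(* The tuples of stage [i.+1] have more than [i] entries. *)
pose P i := nth 0%N (st i.+1).1 i; pose Q i := nth 0%N (st i.+1).2 i.
have PQE n i : (i < size (st n).1)%N ->
    nth 0%N (st n).1 i = P i /\ nth 0%N (st n).2 i = Q i.
  move=> im; rewrite /P /Q.
  have [/agree/(_ im)[-> ->]//|/ltnW/agree] := leqP n i.+1.
  exact.
(* Stage [m] writes [m] at position [a m] of [P] and [b m] of [Q]. *)
pose a m := size (st m).1; pose b m := (size (st m).1).+1.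
have aS m : (a m < size (st m.+1).1)%N by rewrite szS.
have bS m : (b m < size (st m.+1).1)%N by rewrite szS.
have PaK m : P (a m) = m.
  have [<- _] := PQE _ _ (aS m).
  by rewrite /= !nth_rcons !size_rcons /a leqnn ltnn eqxx.
have QbK m : Q (b m) = m.
  have [_ <-] := PQE _ _ (bS m).
  by rewrite /= !nth_rcons !size_rcons /b psz ltnn eqxx.
have PQ i j : P i = P j <-> Q i = Q j.
  have iM : (i < size (st (maxn i j).+1).1)%N.
    by apply: leq_trans (szge _); rewrite ltnS leq_maxl.
  have jM : (j < size (st (maxn i j).+1).1)%N.
    by apply: leq_trans (szge _); rewrite ltnS leq_maxr.
  have [<- <-] := PQE _ _ iM; have [<- <-] := PQE _ _ jM.
  by have [[_ ijP _] _ _] := bf _ _ (Sst (maxn i j).+1); apply: ijP.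
have gP i : Q (a (P i)) = Q i by apply/PQ; rewrite PaK.
exists (Q \o a).
  split.
    exists (P \o b) => m /=; first by rewrite -[RHS]PaK; apply/PQ; rewrite QbK.
    by rewrite gP QbK.
  move=> k s; pose l := (\max_(m <- s) m).+1.
  have sl i : i \in map a s -> (i < size (st l).1)%N.
    move=> /mapP[m ms ->]; apply: leq_trans (aS m) _; apply: szmono.
    by rewrite ltnS (big_rem m) //= leq_maxl.
  have [[_ _ /(_ k (map a s)) kP] _ _] := bf _ _ (Sst l); move: kP.
  have -> : map (nth 0%N (st l).1) (map a s) = s.
    rewrite -[RHS]map_id -map_comp; apply/eq_in_map => m ms /=.
    by have [-> _] := PQE l (a m) (sl _ (map_f _ ms)).
  have -> : map (nth 0%N (st l).2) (map a s) = map (Q \o a) s.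
    rewrite -map_comp; apply/eq_in_map => m ms /=.
    by have [_ ->] := PQE l (a m) (sl _ (map_f _ ms)).
  by apply; apply/allP => i /sl.
apply: (@eq_from_nth _ 0%N); first by rewrite size_map -(psz 0%N).
move=> i; rewrite size_map => ip; rewrite (nth_map 0%N) //.
by have [-> ->] := PQE 0%N i ip; apply: gP.
Qed.

End BackAndForth.

(** * Generic ergodicity for coarse adjacency on the Baire space *)
Definition adj (a b : nat) : bool := (a <= b.+1)%N && (b <= a.+1)%N.

Lemma adjxx : reflexive adj. Proof. by move=> a; rewrite /adj leqnSn. Qed.

Lemma adjC : symmetric adj. Proof. by move=> a b; rewrite /adj andbC. Qed.

Definition cylinders (_ : nat) : set nat := setT.

Definition adj_pairs (_ : nat) : set (nat * nat) := [set v | adj v.1 v.2].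

Definition neighbours (x : nat -> nat) (i : nat) : set nat := [set v | adj (x i) v].

Definition splice (s : seq nat) (x : nat -> nat) (i : nat) : nat :=
  if (i < size s)%N then nth 0%N s i else x i.

Definition tail_eq (x y : nat -> nat) : Prop :=
  exists n, forall i, (n <= i)%N -> x i = y i.

Lemma tail_eq_trans x y z : tail_eq x y -> tail_eq y z -> tail_eq x z.
Proof.
move=> [m xy] [n yz]; exists (maxn m n) => i; rewrite geq_max => /andP[mi ni].
by rewrite xy // yz.
Qed.

Lemma cylindersP i : cylinders i 0%N. Proof. by []. Qed.

Lemma adj_pairsP i : adj_pairs i (0%N, 0%N). Proof. exact: adjxx. Qed.

Lemma neighboursP x i : neighbours x i (x i). Proof. exact: adjxx. Qed.

Lemma mkseqP (V : Type) (z w : nat -> V) n :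
  (forall i, (i < n)%N -> z i = w i) -> mkseq z n = mkseq w n.
Proof. by move=> zw; apply/eq_in_map => i; rewrite mem_iota; apply: zw. Qed.

Lemma mkseq_eq (V : eqType) (z w : nat -> V) n i :
  mkseq z n = mkseq w n -> (i < n)%N -> z i = w i.
Proof. by move=> /eq_in_map zw ni; apply: zw; rewrite mem_iota. Qed.

Lemma box_mkseqE (V : countType) (e : nat -> set V) z w n : box e (mkseq z n) w <->
  (forall i, (i < n)%N -> w i = z i) /\ (forall i, (n <= i)%N -> e i (w i)).
Proof.
rewrite /box /= size_mkseq; split=> -[wz ew]; split=> //.
  by move=> i; apply: mkseq_eq.
exact: mkseqP.
Qed.

Lemma box_agree (V : countType) (e : nat -> set V) c z w i :
  box e c z -> box e c w -> (i < size c)%N -> z i = w i.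
Proof. by move=> [zc _] [wc _] ic; apply: mkseq_eq ic; rewrite zc wc. Qed.

Lemma boxE (V : countType) (e : nat -> set V) c z w : box e c z ->
  (forall i, (i < size c)%N -> w i = z i) -> (forall i, (size c <= i)%N -> e i (w i)) ->
  box e c w.
Proof. by move=> [zc _] wz ew; split=> //; rewrite -[RHS]zc; apply: mkseqP. Qed.

(** Used with the two projections; a neighbour of a projected point that avoids
    [M] is lifted to the diagonal pair, which is adjacent. *)
Lemma meager_proj (pr : nat * nat -> nat) (M : set (nat -> nat)) :
  (forall v, pr (v, v) = v) -> meager cylinders M ->
  meager adj_pairs [set z | M (pr \o z)].
Proof.
move=> prK [N nN MN]; exists (fun n => [set z | N n (pr \o z)]); last first.
  by move=> z /MN[n _ Nz]; exists n.
move=> n c; have [c0 c0c] := box_neq0 adj_pairsP c.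
have [d dc dN] := nN n (map pr c).
have [w dw] := box_neq0 cylindersP d.
have wc i : (i < size c)%N -> w i = pr (c0 i).
  move=> ic; have [cc _] := c0c; have [+ _] := dc _ dw; rewrite size_map -{2}cc.
  by rewrite /mkseq -map_comp => /mkseq_eq; apply.
pose z i := if (i < size c)%N then c0 i else (w i, w i).
have zw : pr \o z = w.
  by apply/funext => i; rewrite /z /=; case: ltnP => [/wc|_].
have cz : box adj_pairs c z.
  by apply: (boxE c0c) => i; rewrite /z; [move=> -> | rewrite ltnNge => -> /=; apply: adjxx].
exists (mkseq z (maxn (size c) (size d))).
  by apply: box_mkseq_sub cz _; rewrite leq_maxl.
rewrite -subset0 => y [/box_mkseqE[yz _] Ny].
suff : (box cylinders d `&` N n) (pr \o y) by rewrite dN.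
split=> //.
apply: (boxE dw) => // i id; rewrite -zw /= yz //.
by apply: leq_trans id _; rewrite leq_maxr.
Qed.

Lemma nwd_splice s N : nwd cylinders N -> nwd cylinders [set x | N (splice s x)].
Proof.
move=> nN c; have [x0 cx0] := box_neq0 cylindersP c.
pose n := maxn (size c) (size s).
have [d dn dN] := nN (mkseq (splice s x0) n).
have [w dw] := box_neq0 cylindersP d; have /box_mkseqE[wx _] := dn _ dw.
pose x1 i := if (i < n)%N then x0 i else w i.
have cx1 : box cylinders c x1.
  by apply: (boxE cx0) => // i ic; rewrite /x1 leq_max ic.
exists (mkseq x1 (maxn n (size d))).
  by apply: box_mkseq_sub cx1 _; rewrite !leq_max leqnn.
rewrite -subset0 => x [/box_mkseqE[xx1 _] Nx].
suff : (box cylinders d `&` N) (splice s x) by rewrite dN.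
split=> //.
apply: (boxE dw) => // i id; have im : (i < maxn n (size d))%N by rewrite leq_max id orbT.
have := wx i; rewrite /splice xx1 // /x1.
by case: (ltnP i n) => [_ ->//|]; rewrite geq_max => /andP[_]; rewrite leqNgt => /negbTE ->.
Qed.

(** This makes it possible to choose a generic set closed under finite
    changes, along which the moves of [iso_step] can be chained. *)
Lemma meager_tail_eq M : meager cylinders M ->
  meager cylinders [set x | exists2 y, tail_eq y x & M y].
Proof.
move=> [N nN MN]; apply: (@sub_meager _ _ _ (\bigcup_s [set x | M (splice s x)])).
  move=> x [y [n yx] My]; exists (mkseq y n) => //=.
  rewrite (_ : splice _ _ = y) //; apply/funext => i; rewrite /splice size_mkseq.
  by case: ltnP => [ni|/yx//]; rewrite nth_mkseq.
apply: meager_bigcup => s; exists (fun n => [set x | N n (splice s x)]).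
  by move=> n; apply: nwd_splice.
by move=> x /MN[n _ Nx]; exists n.
Qed.

(** The easy half of the Kuratowski-Ulam theorem, where the topology on the
    sections depends on the point [x].  For a nowhere dense set of pairs, the
    [x] whose section avoids a given box somewhere contain a dense open set. *)
Lemma meager_sections M : meager adj_pairs M -> exists2 M', meager cylinders M' &
  forall x, ~ M' x -> meager (neighbours x) [set y | M (fun i => (x i, y i))].
Proof.
move=> [N nN MN].
pose D n t x := exists2 t', box (neighbours x) t' `<=` box (neighbours x) t &
  box (neighbours x) t' `&` [set y | N n (fun i => (x i, y i))] = set0.
exists (\bigcup_(nt : nat * seq nat) [set x | ~ D nt.1 nt.2 x]); last first.
  move=> x noD; exists (fun n => [set y | N n (fun i => (x i, y i))]).
    by move=> n t; apply: contrapT => nD; apply: noD; exists (n, t).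
  by move=> y /MN[n _ Ny]; exists n.
apply: meager_bigcup => -[n t]; apply: nwd_meager => s /=.
have [x sx] := box_neq0 cylindersP s.
have [y ty] := box_neq0 (neighboursP x) t.
pose m := maxn (size s) (size t).
pose y1 i := if (i < size t)%N then y i else x i.
have [d dm dN] := nN n (mkseq (fun i => (x i, y1 i)) m).
have [z dz] := box_neq0 adj_pairsP d; have /box_mkseqE[zxy zadj] := dm _ dz.
pose m' := maxn m (size d).
exists (mkseq (fst \o z) m').
  apply: subset_trans (_ : box _ (mkseq x m) `<=` _); last first.
    by apply: box_mkseq_sub sx _; rewrite leq_maxl.
  move=> w /box_mkseqE[wz _]; apply/box_mkseqE; split=> // i im.
  by rewrite wz /= ?zxy // leq_max im.
rewrite -subset0 => x' [/box_mkseqE[x'z _]]; apply.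
exists (mkseq (snd \o z) m').
  move=> y' /box_mkseqE[y'z y'x].
  have y'y i : (i < size t)%N -> y' i = y i.
    move=> it; have im : (i < m)%N by rewrite leq_max it orbT.
    by rewrite y'z /= ?zxy /= /y1 ?it // leq_max im.
  split; first by rewrite -[RHS](proj1 ty); apply: mkseqP.
  move=> i ti; have [im'|] := ltnP i m'; last exact: y'x.
  rewrite /neighbours /= x'z // y'z //=; have [im|/zadj//] := ltnP i m.
  by rewrite zxy // /y1 ltnNge ti /= adjxx.
rewrite -subset0 => y' [/box_mkseqE[y'z y'x] Ny'].
suff : (box adj_pairs d `&` N n) (fun i => (x' i, y' i)) by rewrite dN.
split; last exact: Ny'.
apply: (boxE dz) => i id.
  have im : (i < m')%N by rewrite leq_max id orbT.
  by rewrite x'z // y'z //=; case: (z i).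
rewrite /adj_pairs /=; have [im'|/y'x//] := ltnP i m'.
by rewrite x'z // y'z //=; have [_] := dz; apply.
Qed.

Lemma box_neighbours_tail_eq x x' n : (forall i, (n <= i)%N -> x i = x' i) ->
  forall t, (n <= size t)%N -> box (neighbours x) t = box (neighbours x') t.
Proof.
move=> xx' t nt; apply/seteqP; split=> y [yt yx]; split=> // i ti.
  by rewrite /neighbours -xx'; [exact: yx | exact: leq_trans ti].
by rewrite /neighbours xx'; [exact: yx | exact: leq_trans ti].
Qed.

(** Points with equal tails constrain the tails of their neighbours in the same
    way, so sufficiently long words define the same boxes for both. *)
Lemma meager_neighbours_tail_eq x x' M : tail_eq x x' ->
  meager (neighbours x) M -> meager (neighbours x') M.
Proof.
move=> [n xx'] [N nN MN]; exists N => // k t.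
have boxE := box_neighbours_tail_eq xx'.
have [y ty] := box_neq0 (neighboursP x') t.
have [u ut uN] := nN k (mkseq y (maxn n (size t))).
have [w uw] := box_neq0 (neighboursP x) u.
have uw_sub : box (neighbours x') (mkseq w (maxn n (size u))) `<=` box (neighbours x) u.
  rewrite -boxE ?size_mkseq ?leq_maxl //.
  by apply: box_mkseq_sub uw _; rewrite leq_maxr.
exists (mkseq w (maxn n (size u))).
  apply: subset_trans uw_sub _; apply: subset_trans ut _.
  rewrite boxE ?size_mkseq ?leq_maxl //.
  by apply: box_mkseq_sub ty _; rewrite leq_maxr.
by rewrite -subset0 -uN; apply: setSI.
Qed.

Section GenericErgodicity.
Context (K : countType) (T : (nat -> nat) -> K -> seq nat -> Prop).
Hypothesis baire_T : forall k s, baire_property cylinders [set x | T x k s].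
Hypothesis hom_T : forall x y, (exists n, forall i, (n <= i)%N -> adj (x i) (y i)) ->
  exists g, iso (T x) (T y) g.

Lemma generic_continuity : exists2 M, meager cylinders M &
  forall x, ~ M x -> forall k s, exists n, forall y, ~ M y ->
    (forall i, (i < n)%N -> y i = x i) -> T y k s <-> T x k s.
Proof.
have [M MP] := choice (fun ks : K * seq nat =>
  let: ex_intro2 M a b := baire_property_continuous (baire_T ks.1 ks.2) in
  ex_intro (fun M => meager cylinders M /\ _) M (conj a b)).
exists (\bigcup_ks M ks); first by apply: meager_bigcup => ks; apply: (MP ks).1.
move=> x nMx k s.
have nM y : ~ (\bigcup_ks M ks) y -> ~ M (k, s) y.
  by apply: contra_not => My; exists (k, s).
have [c cx cT] := (MP (k, s)).2 x (nM _ nMx).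
exists (size c) => y /nM nMy yx.
have cy : box cylinders c y by exact: boxE cx yx _.
by case: cT => cT; split=> Th; have //= := cT _ cx (nM _ nMx); have //= := cT _ cy nMy.
Qed.

Definition iso_at p q : set (nat -> nat * nat) :=
  [set z | iso_tuples (T (fst \o z)) (T (snd \o z)) p q].

(** Since [iso_at p q] quantifies over isomorphisms, its Baire property does not
    follow from that of the relations by closure properties.  At a generic point, the pairs of tuples that are forced to be
    matched near that point form a back-and-forth system, so what is forced is
    true. *)
Lemma iso_at_comeager p q c : ~ meager adj_pairs (iso_at p q `&` box adj_pairs c) ->
  exists2 c', box adj_pairs c' `<=` box adj_pairs c &
    meager adj_pairs (box adj_pairs c' `\` iso_at p q).
Proof.
move=> /nonmeager_localize[c' c'c Ac']; exists c' => //.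
have [M0 mM0 contT] := generic_continuity.
pose forced p q : set (nat -> nat * nat) :=
  [set z | exists2 c, box adj_pairs c z & everywhere_nonmeager adj_pairs (iso_at p q) c].
pose bad1 := \bigcup_(pqm : seq nat * seq nat * nat) [set z |
  forced pqm.1.1 pqm.1.2 z /\
  forall n, ~ forced (rcons pqm.1.1 pqm.2) (rcons pqm.1.2 n) z].
pose bad2 := \bigcup_(pqn : seq nat * seq nat * nat) [set z |
  forced pqn.1.1 pqn.1.2 z /\
  forall m, ~ forced (rcons pqn.1.1 m) (rcons pqn.1.2 pqn.2) z].
pose dis := [set z | M0 (fst \o z)] `|` [set z | M0 (snd \o z)].
have mdis : meager adj_pairs dis by apply: meagerU; apply: meager_proj.
apply: (@sub_meager _ _ _ (dis `|` (bad1 `|` bad2))); last first.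
  apply: meagerU => //; apply: meagerU; apply: meager_bigcup => -[[p1 q1] m] /=;
    apply: forced_bigcup_meager => z /=.
  - by move=> /iso_tuples_forth/(_ m)[n ?]; exists n.
  - by move=> /iso_tuples_back/(_ m)[n ?]; exists n.
move=> z [c'z]; apply: contra_notP => /not_orP[ndis /not_orP[nbad1 nbad2]].
apply: (@back_and_forth_iso _ _ _ (fun p q => forced p q z)); last by exists c'.
move=> p1 q1 fz; split; last 2 first.
- move=> m; apply: contrapT => nf; apply: nbad1; exists (p1, q1, m) => //=.
  by split=> // n fn; apply: nf; exists n.
- move=> m; apply: contrapT => nf; apply: nbad2; exists (p1, q1, m) => //=.
  by split=> // n fn; apply: nf; exists n.
have [b bz bA] := fz.
have meet a : box adj_pairs a `<=` box adj_pairs b ->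
    exists w, [/\ iso_at p1 q1 w, box adj_pairs a w & ~ dis w].
  move=> ab; apply: contrapT => no; apply: (bA a ab).
  by apply: sub_meager mdis => w [? ?]; apply: contrapT => ?; apply: no; exists w.
have [w [/iso_tuples_partial_iso[szw eqw _] _ _]] := meet b (@subset_refl _ _).
split=> // k I Ip.
have [[n1 z1] [n2 z2]] : (exists n, forall y, ~ M0 y ->
      (forall i, (i < n)%N -> y i = (z i).1) ->
      T y k (map (nth 0%N p1) I) <-> T (fst \o z) k (map (nth 0%N p1) I)) /\
    (exists n, forall y, ~ M0 y -> (forall i, (i < n)%N -> y i = (z i).2) ->
      T y k (map (nth 0%N q1) I) <-> T (snd \o z) k (map (nth 0%N q1) I)).
  by split; apply: contT => Mz; apply: ndis; [left|right].
pose n := maxn (size b) (maxn n1 n2).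
have [v [/iso_tuples_partial_iso[_ _ vI] /box_mkseqE[vz _] /not_orP[v1 v2]]] :=
  meet (mkseq z n) (box_mkseq_sub bz (leq_maxl _ _)).
rewrite -(z1 (fst \o v)) -?(z2 (snd \o v)) //; first exact: vI.
  by move=> i ni; rewrite /= vz // !leq_max ni !orbT.
by move=> i ni; rewrite /= vz // !leq_max ni !orbT.
Qed.

(** The generic isomorphisms send [p] to a fixed tuple [q] of the second
    structure; only their composition, which fixes [p], matters later. *)
Definition good p (c : seq (nat * nat)) : Prop :=
  exists q, meager adj_pairs (box adj_pairs c `\` iso_at p q).

Definition fiber (c : seq (nat * nat)) : set (nat -> nat) := box cylinders (map fst c).

(** There are countably many choices of [q], and over any box of adjacent pairs
    they cover everything, because adjacent points have isomorphic
    structures. *)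
Lemma good_dense p s : exists2 c, good p c & fiber c `<=` box cylinders s.
Proof.
pose c0 := [seq (v, v) | v <- s].
have [q /iso_at_comeager[c' c'c0 mc']] :
    exists q, ~ meager adj_pairs (iso_at p q `&` box adj_pairs c0).
  apply: contrapT => /forallNP no; apply: (box_nonmeager adj_pairsP (c := c0)).
  apply: (@sub_meager _ _ _ (\bigcup_q (iso_at p q `&` box adj_pairs c0))).
    move=> z cz; have [|g gi] := hom_T (x := fst \o z) (y := snd \o z).
      by exists (size c0) => i; have [_] := cz; apply.
    by exists (map g p) => //; split=> //; exists g.
  by apply: meager_bigcup => q; apply: contrapT; apply: no.
exists c'; first by exists q.
move=> x xc'; have [z0 z0c'] := box_neq0 adj_pairsP c'.
pose z i := if (i < size c')%N then z0 i else (x i, x i).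
have z0x i : (i < size c')%N -> (z0 i).1 = x i.
  move=> ic; have [z0E _] := z0c'; have [+ _] := xc'; rewrite size_map -{2}z0E.
  by rewrite /mkseq -map_comp => /mkseq_eq ->.
have /c'c0 [zc0 _] : box adj_pairs c' z.
  by apply: (boxE z0c') => i; rewrite /z; [move=> -> | rewrite ltnNge => -> /=; apply: adjxx].
split=> //; have := congr1 (map fst) zc0; rewrite size_map /mkseq -!map_comp map_id => sE.
rewrite -[RHS]sE; apply/eq_map => i; rewrite /z /=.
by case: ltnP => [/z0x|].
Qed.

(** The points [x] and [x'] have a common neighbour [y] for which both pairs
    are generic in [box c]; compose the isomorphism from [x] to [y] with the
    inverse of the one from [x'] to [y]. *)
Lemma iso_step p q c x x' n :
  meager (neighbours x) [set y | (box adj_pairs c `\` iso_at p q) (fun i => (x i, y i))] ->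
  meager (neighbours x') [set y | (box adj_pairs c `\` iso_at p q) (fun i => (x' i, y i))] ->
  fiber c x -> (size c <= n)%N -> (forall i, i != n -> x' i = x i) -> adj (x n) (x' n) ->
  iso_tuples (T x) (T x') p p.
Proof.
move=> mx mx' cx cn x'x xx'n.
have [z0 z0c] := box_neq0 adj_pairsP c.
have z0x i : (i < size c)%N -> (z0 i).1 = x i.
  move=> ic; have [z0E _] := z0c; have [+ _] := cx; rewrite size_map -{2}z0E.
  by rewrite /mkseq -map_comp => /mkseq_eq ->.
have x'xi i : (n < i)%N -> x' i = x i by move=> ni; rewrite x'x // gtn_eqF.
have {}mx' : meager (neighbours x)
    [set y | (box adj_pairs c `\` iso_at p q) (fun i => (x' i, y i))].
  by apply: meager_neighbours_tail_eq mx'; exists n.+1 => i; apply: x'xi.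
(* At [n] the common neighbour takes the value [x n], which is adjacent to [x' n] too. *)
pose y i := if (i < size c)%N then (z0 i).2 else x i.
have [y' [/box_mkseqE[y'y y'x] ny]] : exists y', box (neighbours x) (mkseq y n.+1) y' /\
    ~ ((box adj_pairs c `\` iso_at p q) (fun i => (x i, y' i)) \/
       (box adj_pairs c `\` iso_at p q) (fun i => (x' i, y' i))).
  apply: contrapT => no; apply: (box_nonmeager (neighboursP x) (c := mkseq y n.+1)).
  apply: sub_meager (meagerU mx mx') => y' y'box.
  by apply: contrapT => nM; apply: no; exists y'.
have yc i : (i < size c)%N -> (x i, y' i) = z0 i.
  move=> ic; rewrite y'y ?ltnS ?(leq_trans (ltnW ic)) // /y ic -z0x //.
  by case: (z0 i).
have adjy i : (size c <= i)%N -> adj (x i) (y' i) /\ adj (x' i) (y' i).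
  move=> ci; have [ni|iN] := ltnP n i; first by rewrite x'xi //; split; apply: y'x.
  rewrite y'y // /y ltnNge ci /=; split; first exact: adjxx.
  by have [->|/x'x ->] := eqVneq i n; [rewrite adjC | exact: adjxx].
have bx : box adj_pairs c (fun i => (x i, y' i)).
  by apply: (boxE z0c) => // i /adjy[].
have bx' : box adj_pairs c (fun i => (x' i, y' i)).
  apply: (boxE z0c) => i ic; last by have [] := adjy i ic.
  by rewrite x'x ?yc // ltn_eqF // (leq_trans ic).
have /not_orP[h1 h2] := ny.
have i1 : iso_at p q (fun i => (x i, y' i)) by apply: contrapT => h; apply: h1.
have i2 : iso_at p q (fun i => (x' i, y' i)) by apply: contrapT => h; apply: h2.
exact: iso_tuples_trans i1 (iso_tuples_sym i2).
Qed.

(** The back-and-forth system between [x] and [y] matches [p] with [q] when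
    finite modifications of [x] and [y] lying in the fiber of one good box for
    a tuple [r] carry [p] and [q] to [r].  To extend it, the modification of
    [y] is moved by [reach] into a smaller good box around that of [x],
    without disturbing [r]. *)
Theorem generic_ergodicity : exists2 M, meager cylinders M &
  forall x y, ~ M x -> ~ M y -> exists g, iso (T x) (T y) g.
Proof.
have [M0 mM0 contT] := generic_continuity.
pose E pqc : set (nat -> nat * nat) :=
  let: (p, q, c) := pqc in box adj_pairs c `\` iso_at p q.
have exM1 pqc : exists M1, meager cylinders M1 /\ (meager adj_pairs (E pqc) ->
    forall x, ~ M1 x -> meager (neighbours x) [set y | E pqc (fun i => (x i, y i))]).
  have [/meager_sections[M' mM' M'P]|nm] := pselect (meager adj_pairs (E pqc)).
    by exists M'.
  by exists set0; split=> //; apply: nwd_meager => a; exists a => //; rewrite setI0.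
have {exM1}[M1 M1P] := choice exM1.
pose M2 p := [set x | ~ exists2 c, good p c & fiber c x].
have mM2 p : meager cylinders (M2 p).
  apply: nwd_meager => s; have [c gc cs] := good_dense p s.
  exists (map fst c) => //; rewrite -subset0 => x [cx]; apply; by exists c.
pose MM := M0 `|` ((\bigcup_pqc M1 pqc) `|` \bigcup_p M2 p).
pose M := [set x | exists2 y, tail_eq y x & MM y].
exists M.
  apply: meager_tail_eq; apply: meagerU => //; apply: meagerU; apply: meager_bigcup => //.
  by move=> pqc; apply: (M1P _).1.
have genMM x : ~ M x -> ~ MM x by apply: contra_not => MMx; exists x => //; exists 0%N.
have genM x y : ~ M x -> tail_eq y x -> ~ M y.
  move=> nMx yx; apply: contra_not nMx => -[z zy MMz]; exists z => //.
  exact: tail_eq_trans yx.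
pose upd (x : nat -> nat) n v i := if i == n then v else x i.
have upd_tail x n v : tail_eq (upd x n v) x.
  by exists n.+1 => i ni; rewrite /upd gtn_eqF.
have move1 p c x n v : good p c -> fiber c x -> ~ M x -> (size c <= n)%N ->
    iso_tuples (T x) (T (upd x n v)) p p.
  move=> [q mq] cx nMx cn.
  have sec y : ~ M y -> meager (neighbours y)
      [set z | (box adj_pairs c `\` iso_at p q) (fun i => (y i, z i))].
    move=> /genMM/not_orP[_ /not_orP[nM1 _]].
    by apply: ((M1P (p, q, c)).2 mq); apply: contra_not nM1; exists (p, q, c).
  have fib w : fiber c (upd x n w).
    apply: (boxE cx) => // i; rewrite size_map => ic.
    by rewrite /upd ltn_eqF // (leq_trans ic).
  have up w : iso_tuples (T (upd x n 0%N)) (T (upd x n w)) p p.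
    elim: w => [|w IH]; first exact: iso_tuples_refl.
    apply: iso_tuples_trans IH _.
    apply: (@iso_step p q c _ _ n) => //; try by apply: sec; apply: genM nMx _.
      by move=> i /negbTE; rewrite /upd => ->.
    by rewrite /upd eqxx /adj leqnn leqW.
  have := up (x n); rewrite (_ : upd x n (x n) = x); last first.
    by apply/funext => i; rewrite /upd; case: eqVneq => [->|].
  by move=> /iso_tuples_sym/iso_tuples_trans; apply.
have reach p c x y n : good p c -> fiber c x -> fiber c y -> ~ M x ->
    exists x', [/\ tail_eq x' x, iso_tuples (T x) (T x') p p &
      forall i, (i < n)%N -> x' i = y i].
  move=> pc cx cy nMx.
  suff [x' [? ? ? _]] : exists x', [/\ tail_eq x' x, iso_tuples (T x) (T x') p p,
      forall i, (i < n)%N -> x' i = y i & fiber c x'] by exists x'.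
  elim: n => [|n [x' [x'x xx' x'y cx']]].
    by exists x; split=> //; [exists 0%N | exact: iso_tuples_refl].
  have [nc|cn] := ltnP n (size c).
    exists x'; split=> // i; rewrite ltnS leq_eqVlt => /orP[/eqP ->|]; last exact: x'y.
    by apply: box_agree cx' cy _; rewrite size_map.
  exists (upd x' n (y n)); split.
  - exact: tail_eq_trans x'x.
  - by apply: iso_tuples_trans xx' _; apply: (move1 _ c) => //; apply: genM x'x.
  - move=> i; rewrite ltnS leq_eqVlt /upd => /orP[/eqP ->|]; first by rewrite eqxx.
    by move=> ni; rewrite ltn_eqF // x'y.
  - apply: (boxE cx') => // i; rewrite size_map => ic.
    by rewrite /upd ltn_eqF // (leq_trans ic).
have goodM p x : ~ M x -> exists2 c, good p c & fiber c x.
  by move=> /genMM/not_orP[_ /not_orP[_ nM2]]; apply: contrapT => h; apply: nM2; exists p.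
(* [r] is the common image of [p] and [q] in two nearby structures. *)
pose B x y p q := exists r x' y' c, [/\ good r c, fiber c x' /\ fiber c y',
  tail_eq x' x /\ tail_eq y' y, iso_tuples (T x) (T x') p r & iso_tuples (T y) (T y') q r].
have Bsym x y p q : B x y p q -> B y x q p.
  by move=> [r [x' [y' [c [? [? ?] [? ?] ? ?]]]]]; exists r, y', x', c.
have forth x y p q : ~ M x -> ~ M y -> B x y p q ->
    forall m, exists n, B x y (rcons p m) (rcons q n).
  move=> nMx nMy [r [x' [y' [c [rc [cx' cy'] [x'x y'y] xx' yy']]]]] m.
  have [k xx'k] := iso_tuples_forth xx' m.
  have nMx' := genM _ _ nMx x'x; have nMy' := genM _ _ nMy y'y.
  have [d rkd dx'] := goodM (rcons r k) _ nMx'.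
  have [y'' [y''y' y'y'' y''x']] := reach r c y' x' (size d) rc cy' cx' nMy'.
  have [n yn] := iso_tuples_back (iso_tuples_trans yy' y'y'') k.
  exists n, (rcons r k), x', y'', d; split=> //; split=> //.
    by apply: (boxE dx') => // i; rewrite size_map; apply: y''x'.
  exact: tail_eq_trans y'y.
move=> x y nMx nMy.
suff [g gi _] : iso_tuples (T x) (T y) [::] [::] by exists g.
have B0 : B x y [::] [::].
  exists [::], x, y, [::]; split=> //; try exact: iso_tuples_refl.
  - exists [::]; rewrite (_ : _ `\` _ = set0).
      by apply: nwd_meager => a; exists a => //; rewrite setI0.
    rewrite -subset0 => z [[_ adjz]]; apply.
    have [|g gi] := hom_T (x := fst \o z) (y := snd \o z).
      by exists 0%N => i i0; apply: adjz.
    by exists g.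
  - by split; exists 0%N.
apply: (back_and_forth_iso _ B0) => p q Bpq; split; last 2 first.
- exact: forth.
- move=> n; have [m] := forth y x q p nMy nMx (Bsym _ _ _ _ Bpq) n.
  by move=> /Bsym ?; exists m.
have [r [x' [y' [c [rc [cx' cy'] [x'x y'y] xx' yy']]]]] := Bpq.
have nMx' := genM _ _ nMx x'x; have nMy' := genM _ _ nMy y'y.
have [szp eqp atp] := iso_tuples_partial_iso xx'.
have [szq eqq atq] := iso_tuples_partial_iso (iso_tuples_sym yy').
split; first by rewrite szp.
  by move=> i j ip jp; rewrite eqp // eqq -?szp.
move=> k I Ip; rewrite atp // -atq -?szp //.
have /genMM/not_orP[/contT/(_ k (map (nth 0%N r) I))[n x'n] _] := nMx'.
have [y'' [y''y' y'y'' y''x']] := reach r c y' x' n rc cy' cx' nMy'.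
rewrite -(x'n y'') //; last by have /genMM/not_orP[] := genM _ _ nMy' y''y'.
have [_ _ at''] := iso_tuples_partial_iso y'y''.
by rewrite at'' // -szp.
Qed.

End GenericErgodicity.

(** * Borel sets of sequences and of structures *)

Lemma open_measurable_borel (T : ptopologicalType) (A : set (borel_space T)) :
  open (A : set T) -> measurable A.
Proof. by move=> oA; apply: sub_sigma_algebra. Qed.

Lemma open_coord (I : eqType) (K : I -> topologicalType) (i : I) (A : set (K i)) :
  open A -> open [set y : prod_topology K | A (y i)].
Proof.
have ci : continuous (fun y : prod_topology K => y i) by exact: (@proj_continuous I K i).
by move=> oA; apply: (proj1 (continuousP _) ci).
Qed.

Lemma measurable_E0_coord n : measurable [set y : E0_space | y n].
Proof.
apply: open_measurable_borel.
by apply: (@open_coord nat (fun=> bool) n [set true]); apply: discrete_open.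
Qed.

(** Otherwise the neighbourhood would miss a sequence that converges to its
    centre. *)
Lemma nbhs_cantor_cylinder (y : cantor_space) (U : set cantor_space) : nbhs y U ->
  exists n, forall z : cantor_space, (forall i, (i < n)%N -> z i = y i) -> U z.
Proof.
move=> yU; apply: contrapT => /forallNP noU.
have {}noU n : exists z : cantor_space, (forall i, (i < n)%N -> z i = y i) /\ ~ U z.
  by have /existsNP[z /not_implyP[zy nU]] := noU n; exists z.
have {noU}[z zP] := choice noU.
have zy : z @ \oo --> y.
  apply: (proj2 (cvg_sup _ _ _)) => i U0 [V [[W oW <-] Wy VU]].
  exists i.+1 => // n /= ni; apply: VU; rewrite /= (zP n).1 //.
have [n _ /(_ n (leqnn n))] := zy _ yU.
exact: (zP n).2.
Qed.

Lemma measurable_fun_E0_space d (X : measurableType d) (f : X -> E0_space) :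
  (forall n, measurable [set x | f x n]) -> measurable_fun setT f.
Proof.
move=> mf; apply: (@measurability _ _ _ E0_space setT f (@open cantor_space) erefl).
move=> _ [U oU <-]; rewrite setTI.
have -> : f @^-1` U = \bigcup_(s in [set s : seq bool |
    (fun y : E0_space => mkseq y (size s) = s) `<=` U]) [set x | mkseq (f x) (size s) = s].
  apply/seteqP; split=> [x Ufx|x [s sU sx]]; last exact: sU.
  have [n nU] := nbhs_cantor_cylinder (open_nbhs_nbhs (conj oU Ufx)).
  exists (mkseq (f x) n); rewrite /= size_mkseq // => y yx.
  by apply: nU => i; apply: mkseq_eq.
rewrite bigcup_mkcond; apply: countable_bigcupT_measurable => // s.
case: ifP => // _.
have -> : [set x | mkseq (f x) (size s) = s] =
    \bigcap_i (if (i < size s)%N then if nth true s i then [set x | f x i]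
               else ~` [set x | f x i] else setT).
  apply/seteqP; split=> [x xs i _|x xs].
    case: ltnP => // ni; rewrite -xs nth_mkseq //=; by case: ifPn => // /negP.
  apply: (@eq_from_nth _ true); rewrite size_mkseq // => i si.
  have := xs i I; rewrite si nth_mkseq //=.
  by case: (nth true s i) => /= [->//|/negP/negbTE].
apply: bigcapT_measurable => i; case: ifP => // _; case: ifP => // _.
exact: measurableC.
Qed.

Definition symbol (L : signature) : countType := (fun_symbol L + rel_symbol L)%type.

(** A function symbol contributes its graph, with the value in front of the
    arguments. *)
Definition relations (L : signature) (M : structure_space L) (k : symbol L) (s : seq nat) : Prop :=
  match k with
  | inl i => exists2 a : (fun_arity i).-tuple nat, s = M.1 i a :: a & True
  | inr j => exists2 a : (rel_arity j).-tuple nat, s = a & M.2 j a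
  end.

Lemma structure_isoP (L : signature) (M N : structure_space L) :
  structure_iso M N <-> exists g, iso (relations M) (relations N) g.
Proof.
split=> [[g [gb gf gr]]|[g [gb gP]]].
  exists g; split=> // -[i|j] s /=.
    split=> [[a -> _]|[a]].
      by exists (map_tuple g a); rewrite //= gf.
    case: s => //= n s [nE sE] _; have szs : size s = fun_arity i.
      by rewrite -(size_map g) sE size_tuple.
    exists (Tuple (introT eqP szs)) => //=; congr (_ :: _).
    apply: (bij_inj gb); rewrite gf nE; congr (N.1 i _).
    by apply: val_inj; rewrite /= sE.
  split=> [[a ->]|[a sE Na]].
    by rewrite gr; exists (map_tuple g a).
  have szs : size s = rel_arity j by rewrite -(size_map g) sE size_tuple.
  exists (Tuple (introT eqP szs)) => //=; rewrite gr.
  by rewrite (_ : map_tuple _ _ = a) //; apply: val_inj.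
exists g; split=> // [i a|j a].
  have [+ _] := gP (inl i) (M.1 i a :: a); case=> [|b [-> abE] _]; first by exists a.
  by congr (N.1 i _); apply: val_inj.
have {gP}[gP1 gP2] := gP (inr j) a; apply/idP/idP => [Ma|Na].
  have [|b abE] := gP1; first by exists a.
  by rewrite (_ : map_tuple _ _ = b) //; apply: val_inj.
have [|b abE] := gP2; first by exists (map_tuple g a).
by rewrite (_ : a = b) //; apply: val_inj.
Qed.

Lemma measurable_fun_value (L : signature) (i : fun_symbol L) a n :
  measurable [set M : structure_space L | M.1 i a = n].
Proof.
apply: (@open_measurable_borel (structures L) [set M | M.1 i a = n]).
have oA : open [set f : fun_interp L | (f i : {ptws _ -> nat}) a = n].
  apply: (@open_coord _ (fun i : fun_symbol L => {ptws (fun_arity i).-tuple nat -> nat}) i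
    [set f | f a = n]).
  by apply: (@open_coord _ (fun=> nat) a [set n]); apply: discrete_open.
have cf : continuous (fst : structures L -> fun_interp L) by move=> x; apply: cvg_fst.
exact: (proj1 (continuousP _) cf _ oA).
Qed.

Lemma measurable_rel_value (L : signature) (j : rel_symbol L) a :
  measurable [set M : structure_space L | M.2 j a].
Proof.
apply: (@open_measurable_borel (structures L) [set M : structures L | M.2 j a]).
have oA : open [set f : rel_interp L | (f j : {ptws _ -> bool}) a].
  apply: (@open_coord _ (fun j : rel_symbol L => {ptws (rel_arity j).-tuple nat -> bool}) j
    [set f | f a]).
  by apply: (@open_coord _ (fun=> bool) a [set true]); apply: discrete_open.
have cs : continuous (snd : structures L -> rel_interp L) by move=> x; apply: cvg_snd.
exact: (proj1 (continuousP _) cs _ oA).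
Qed.

Lemma measurable_relations (L : signature) (k : symbol L) (s : seq nat) :
  measurable [set M : structure_space L | relations M k s].
Proof.
case: k => [i|j] /=.
  rewrite (_ : mkset _ = \bigcup_(a : (fun_arity i).-tuple nat)
      [set M : structure_space L | s = M.1 i a :: a]); last first.
    by apply/seteqP; split=> M [a]; [move=> sE _; exists a | exists a].
  apply: countable_bigcupT_measurable => // a; case: s => [|n s].
    by rewrite (_ : mkset _ = set0) //; apply/seteqP; split.
  have [->|sa] := pselect (s = a); last first.
    by rewrite (_ : mkset _ = set0) //; apply/seteqP; split=> // M [_].
  rewrite (_ : mkset _ = [set M : structure_space L | M.1 i a = n]).
    exact: measurable_fun_value.
  by apply/seteqP; split=> M /= => [[->]|->].
rewrite (_ : mkset _ = \bigcup_(a in [set a : (rel_arity j).-tuple nat | s = a])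
    [set M : structure_space L | M.2 j a]); last first.
  by apply/seteqP; split=> M [a]; [move=> sE Ma; exists a | move=> sE Ma; exists a].
rewrite bigcup_mkcond; apply: countable_bigcupT_measurable => // a.
by case: ifP => // _; apply: measurable_rel_value.
Qed.

(** * Probability measure preserving actions *)

Section RealProbability.
Context (R : realType) (d : measure_display) (X : measurableType d).
Context (mu : probability X R).
Implicit Types A B C : set X.

Definition pr A : R := fine (mu A).

Lemma prE A : measurable A -> mu A = (pr A)%:E.
Proof. by move=> mA; rewrite fineK ?fin_num_measure. Qed.

Lemma pr_ge0 A : 0 <= pr A.
Proof. exact: fine_ge0. Qed.

Lemma pr_le1 A : measurable A -> pr A <= 1.
Proof. by move=> mA; rewrite -lee_fin -prE // probability_le1. Qed.

Lemma pr_setT : pr setT = 1.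
Proof. by rewrite /pr probability_setT. Qed.

Lemma pr_set0 : pr set0 = 0.
Proof. by rewrite /pr measure0. Qed.

Lemma le_pr A B : measurable A -> measurable B -> A `<=` B -> pr A <= pr B.
Proof. by move=> mA mB AB; rewrite -lee_fin -!prE // le_measure ?inE. Qed.

Lemma pr_eq0P A : measurable A -> pr A = 0 <-> mu A = 0%E.
Proof. by move=> mA; rewrite prE //; split=> [->//|[]]. Qed.

Lemma pr_setU A B : measurable A -> measurable B -> A `&` B = set0 ->
  pr (A `|` B) = pr A + pr B.
Proof.
move=> mA mB AB; apply: EFin_inj; rewrite EFinD -!prE ?measureU //.
exact: measurableU.
Qed.

Lemma pr_setID A B : measurable A -> measurable B ->
  pr A = pr (A `&` B) + pr (A `\` B).
Proof.
move=> mA mB; rewrite -pr_setU; [by rewrite setUIDK|exact: measurableI|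
  exact: measurableD|by rewrite setDE setIACA setICr setI0].
Qed.

Lemma pr_setC A : measurable A -> pr (~` A) = 1 - pr A.
Proof.
by move=> mA; rewrite -pr_setT (pr_setID measurableT mA) setTI setTD addrAC subrr add0r.
Qed.

Lemma le_pr_setU A B : measurable A -> measurable B -> pr (A `|` B) <= pr A + pr B.
Proof.
move=> mA mB; rewrite -lee_fin EFinD -!prE ?measureU2 //; exact: measurableU.
Qed.

Lemma measurableY A B : measurable A -> measurable B -> measurable (A `+` B).
Proof. by move=> mA mB; rewrite setY_def; apply: measurableU; apply: measurableD. Qed.

Lemma ler_dist_pr A B : measurable A -> measurable B ->
  `|pr A - pr B| <= pr (A `+` B).
Proof.
move=> mA mB; have mAB := measurableY mA mB.
have h : forall C D, measurable C -> measurable D -> pr C - pr D <= pr (C `+` D).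
  move=> C D mC mD; rewrite (pr_setID mC mD).
  have /le_pr : C `&` D `<=` D by []; move=> /(_ (measurableI _ _ mC mD) mD).
  have /le_pr : C `\` D `<=` C `+` D by rewrite setY_def; left.
  by move=> /(_ (measurableD mC mD) (measurableY mC mD)); lra.
by rewrite ler_norml h // lerNl opprB setYC h.
Qed.

Lemma cvg_mu_prP (A : nat -> set X) l : (forall n, measurable (A n)) ->
  (mu (A n) @[n --> \oo] --> l%:E) <-> (pr (A n) @[n --> \oo] --> l).
Proof.
move=> mA; split=> [/fine_cvgP[_]//|prA].
rewrite (_ : (fun n => mu (A n)) = (fun n => (pr (A n))%:E)); last first.
  by apply/funext => n; rewrite prE.
by apply: cvg_EFin => //; near=> n.
Unshelve. all: by end_near. Qed.

Lemma pr_null A B : measurable A -> measurable B -> A `<=` B -> mu B = 0%E -> pr A = 0.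
Proof.
move=> mA mB AB /pr_eq0P B0; apply/eqP; rewrite eq_le pr_ge0 -(B0 mB) andbT.
exact: le_pr.
Qed.

(** Turns the almost sure statement that points leave the sets [F n] eventually
    into convergence of measures, by continuity from above. *)
Lemma cvg_pr_tail (F : nat -> set X) : (forall n, measurable (F n)) ->
  mu (lim_sup_set F) = 0%E -> pr (\bigcup_(k >= n) F k) @[n --> \oo] --> 0.
Proof.
move=> mF F0; apply/cvg_mu_prP => [n|]; first by apply: bigcup_measurable => ? _.
rewrite -[0%:E]F0; apply: lim_sup_set_cvg => //.
apply: le_lt_trans (ltry 1); rewrite probability_le1 //.
by apply: bigcup_measurable => ? _.
Qed.

Lemma measurable_lim_sup_set (F : nat -> set X) :
  (forall n, measurable (F n)) -> measurable (lim_sup_set F).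
Proof.
by move=> mF; apply: bigcapT_measurable => n; apply: bigcup_measurable => k _.
Qed.

End RealProbability.

Section PmpActions.
Context (R : realType) (d : measure_display) (X : measurableType d).
Context (mu : probability X R) (Gamma : groupType) (act : Gamma -> X -> X).
Hypothesis Gamma_countable : countable [set: Gamma].
Hypothesis act_pmp : pmp_action mu act.
Local Notation pr := (pr mu).

Lemma countable_enum : exists e : nat -> Gamma, forall g, exists n, e n = g.
Proof.
have /countable_injP[f finj] := Gamma_countable.
exists (fun n => if pselect (exists g, f g = n) is left h then projT1 (cid h) else 1%g).
move=> g; exists (f g); case: pselect => [h|]; last by case; exists g.
by apply: finj; rewrite ?inE //; case: cid.
Qed.

Lemma actK g : cancel (act g) (act g^-1%g).
Proof. by have [a1 aM _ _] := act_pmp; move=> x; rewrite -aM mulVg a1. Qed.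

Lemma actKV g : cancel (act g^-1%g) (act g).
Proof. by have [a1 aM _ _] := act_pmp; move=> x; rewrite -aM mulgV a1. Qed.

Lemma act_imageE g A : act g @` A = act g^-1%g @^-1` A.
Proof.
apply/seteqP; split=> [_ [x Ax <-]|x Ax]; first by rewrite /preimage /= actK.
by exists (act g^-1%g x) => //; rewrite actKV.
Qed.

Lemma measurable_act_preimage g A : measurable A -> measurable (act g @^-1` A).
Proof.
by have [_ _ mact _] := act_pmp; move=> mA; rewrite -[X in measurable X]setTI; apply: mact.
Qed.

Lemma measurable_act_image g A : measurable A -> measurable (act g @` A).
Proof. by rewrite act_imageE; apply: measurable_act_preimage. Qed.

Lemma pr_act_preimage g A : measurable A -> pr (act g @^-1` A) = pr A.
Proof. by have [_ _ _ pact] := act_pmp; move=> mA; rewrite /pr pact. Qed.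

Lemma pr_act_image g A : measurable A -> pr (act g @` A) = pr A.
Proof. by rewrite act_imageE; apply: pr_act_preimage. Qed.

Lemma act_image_bigcup_enum (e : nat -> Gamma) A : (forall g, exists n, e n = g) ->
  forall g, act g @` (\bigcup_n act (e n) @` A) = \bigcup_n act (e n) @` A.
Proof.
move=> eP; have [a1 aM _ _] := act_pmp.
have sub g : act g @` (\bigcup_n act (e n) @` A) `<=` \bigcup_n act (e n) @` A.
  move=> _ [_ [n _ [x Ax <-]] <-]; have [m em] := eP (g * e n)%g.
  by exists m => //; exists x => //; rewrite em aM.
move=> g; apply/seteqP; split; first exact: sub.
move=> x ex; exists (act g^-1%g x); last by rewrite actKV.
by apply: (sub g^-1%g); exists x.
Qed.

Hypothesis act_ergodic : ergodic mu act.

(** Ergodicity speaks of strictly invariant sets; the saturation of [A] is one,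
    and it differs from [A] by a null set because the group is countable. *)
Lemma ergodic_ae A : measurable A -> (forall g, pr (A `+` act g @` A) = 0) ->
  pr A = 0 \/ pr A = 1.
Proof.
move=> mA A0; have [e eP] := countable_enum; have [a1 _ _ _] := act_pmp.
pose B := \bigcup_n act (e n) @` A.
have mB : measurable B by apply: bigcupT_measurable => n; apply: measurable_act_image.
have AB : A `<=` B.
  by have [n en] := eP 1%g; move=> x Ax; exists n => //; exists x => //; rewrite en a1.
have BA : pr (B `\` A) = 0.
  apply/pr_eq0P; first exact: measurableD.
  apply/negligibleP; first exact: measurableD.
  rewrite setD_bigcupl; apply: negligible_bigcup => n.
  apply: (@negligibleS _ _ _ mu (A `+` act (e n) @` A)).
    by rewrite setY_def; right.
  have mY := measurableY mA (measurable_act_image (e n) mA).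
  by apply/negligibleP => //; apply/pr_eq0P.
have := pr_setID mu mB mA; rewrite BA addr0 setIidr // => <-.
have [B0|B1] := act_ergodic mB (act_image_bigcup_enum A eP).
  by left; rewrite /pr B0.
by right; rewrite /pr B1.
Qed.

End PmpActions.

(** * Strong ergodicity forces homomorphisms to be trivial *)
Section StronglyErgodic.
Context (R : realType) (d : measure_display) (X : measurableType d).
Context (mu : probability X R) (Gamma : groupType) (act : Gamma -> X -> X).
Hypothesis Gamma_countable : countable [set: Gamma].
Hypothesis act_pmp : pmp_action mu act.
Hypothesis act_strongly_ergodic : strongly_ergodic mu act.
Local Notation pr := (pr mu).

Lemma almost_invariantP (A : nat -> set X) : (forall n, measurable (A n)) ->
  almost_invariant mu act A <-> forall g, pr (A n `+` act g @` A n) @[n --> \oo] --> 0.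
Proof.
move=> mA; have mY g n := measurableY (mA n) (measurable_act_image act_pmp g (mA n)).
split=> [[_ A0] g|A0].
  by apply/cvg_mu_prP => //; apply: A0.
by split=> // g; apply/cvg_mu_prP => //; apply: A0.
Qed.

Lemma trivial_sequenceP (A : nat -> set X) : (forall n, measurable (A n)) ->
  trivial_sequence mu A <-> pr (A n) * (1 - pr (A n)) @[n --> \oo] --> 0.
Proof.
move=> mA; rewrite /trivial_sequence (_ : (fun n => _) =
    (fun n => (pr (A n) * (1 - pr (A n)))%:E)); last first.
  by apply/funext => n; rewrite prE.
split=> [/fine_cvgP[_]//|prA].
by apply: cvg_EFin => //; near=> n.
Unshelve. all: by end_near. Qed.

(** If the sets [N n] were to catch almost every point infinitely often, then
    unions of consecutive ones, stopped when they fill half of the space, would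
    be a non-trivial almost invariant sequence. *)
Lemma strongly_ergodic_lim_sup (N : nat -> set X) : (forall n, measurable (N n)) ->
  (forall g, mu (lim_sup_set (fun n => N n `+` act g @` N n)) = 0%E) ->
  pr (N n) @[n --> \oo] --> 0 -> mu (lim_sup_set N) = 0%E.
Proof.
move=> mN NG N0; have [erg sterg] := act_strongly_ergodic.
have mgN g n : measurable (act g @` N n) by apply: (measurable_act_image act_pmp).
have mY g n := measurableY (mN n) (mgN g n).
have mS := measurable_lim_sup_set mN.
have S01 : pr (lim_sup_set N) = 0 \/ pr (lim_sup_set N) = 1.
  apply: (ergodic_ae Gamma_countable act_pmp erg) => // g.
  apply: pr_null (NG g); first by apply: measurableY => //; apply: (measurable_act_image act_pmp).
    exact: measurable_lim_sup_set.
  have lim_sup_image : act g @` lim_sup_set N = lim_sup_set (fun n => act g @` N n).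
    rewrite (act_imageE act_pmp) /lim_sup_set; apply/seteqP; split=> x Sx n _.
      by have [k nk Nk] := Sx n I; exists k => //; rewrite (act_imageE act_pmp).
    by have [k nk] := Sx n I; rewrite (act_imageE act_pmp) => Nk; exists k.
  have sub (F G : nat -> set X) : lim_sup_set F `\` lim_sup_set G `<=`
      lim_sup_set (fun n => F n `+` G n).
    move=> x [Fx] /existsNP[m /not_implyP[_ nG]] n _.
    have [k /= nk Fk] := Fx (maxn m n) I.
    move: nk; rewrite geq_max => /andP[mk nk].
    exists k => //; rewrite setY_def; left; split=> // Gk.
    by apply: nG; exists k.
  rewrite lim_sup_image setY_def subUset; split; first exact: sub.
  have -> : (fun n => N n `+` act g @` N n) = (fun n => act g @` N n `+` N n).
    by apply/funext => n; rewrite setYC.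
  exact: sub.
case: S01 => [S0|S1]; first exact/pr_eq0P.
exfalso.
have tail1 n : pr (\bigcup_(k >= n) N k) = 1.
  apply/eqP; rewrite eq_le pr_le1 /=; last by apply: bigcup_measurable => ? _.
  rewrite -S1; apply: le_pr => //; first by apply: bigcup_measurable => ? _.
  by move=> x /(_ n I).
pose B n m := \bigcup_(k in [set k | n <= k < n + m]%N) N k.
have mB n m : measurable (B n m) by apply: bigcup_measurable => ? _.
have Bcvg n : pr (B n m) @[m --> \oo] --> (1 : R).
  apply/cvg_mu_prP => //.
  have BE : \bigcup_m B n m = \bigcup_(k >= n) N k.
    apply/seteqP; split=> x [k].
      by move=> _ [l /= /andP[nl _] Nl]; exists l.
    move=> /= nk Nk; exists (k - n).+1 => //; exists k => //=.
    by rewrite nk addnS subnKC // ltnSn.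
  rewrite -(tail1 n) -BE -prE; last exact: bigcupT_measurable.
  apply: nondecreasing_cvg_mu => //; first exact: bigcupT_measurable.
  move=> i j ij; apply/subsetPset => x [k /= /andP[nk ki] Nk]; exists k => //=.
  by rewrite nk (leq_trans ki) // leq_add2l.
have exB n : exists m, (2^-1 <= pr (B n m)).
  have /cvgrPdist_lt /(_ 2^-1) := Bcvg n.
  have h2 : (0 : R) < 2^-1 by rewrite invr_gt0.
  move=> /(_ h2)[m _ /(_ m (leqnn m))] /=; rewrite ltr_norml => /andP[_ h].
  by exists m; lra.
pose k n := ex_minn (exB n).
pose C n := B n (k n).
have mC n : measurable (C n) by exact: mB.
(* The last set added brings the measure from below one half to at most one
   half plus its own measure. *)
have half n : 2^-1 <= pr (C n) by rewrite /C /k; case: ex_minnP.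
have upper n : exists2 j, (n <= j)%N & pr (C n) <= 2^-1 + pr (N j).
  rewrite /C /k; case: ex_minnP => -[|m].
    move=> + _; rewrite (_ : B n 0%N = set0) ?pr_set0; first lra.
    by rewrite -subset0 => x [i /= /andP[ni]]; rewrite addn0 ltnNge ni.
  move=> _ minm; exists (n + m)%N; first exact: leq_addr.
  have lt2 : pr (B n m) < 2^-1 by rewrite ltNge; apply/negP => /minm; rewrite ltnn.
  apply: le_trans (_ : pr (B n m `|` N (n + m)%N) <= _).
    apply: le_pr => //; first exact: measurableU.
    move=> x [i /= /andP[ni]]; rewrite addnS ltnS leq_eqVlt => /orP[/eqP ->|im] Ni.
      by right.
    by left; exists i => //=; rewrite ni.
  by apply: le_trans (le_pr_setU _ _ _) _ => //; lra.
have /sterg : almost_invariant mu act C.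
  apply/almost_invariantP => // g.
  apply: (@squeeze_cvgr _ _ _ _ (fun=> 0) (fun n => pr (\bigcup_(k >= n) (N k `+` act g @` N k)))).
  - apply: nearW => n; rewrite pr_ge0 /=; apply: le_pr.
    + by apply: measurableY => //; apply: (measurable_act_image act_pmp).
    + by apply: bigcup_measurable => ? _.
    + rewrite (act_imageE act_pmp) setY_def => x [[[i /= /andP[ni il] Ni] nC]|[[i /= /andP[ni il] Ni] nC]];
      exists i => //; rewrite (act_imageE act_pmp) setY_def.
        by left; split=> // gNi; apply: nC; exists i => //=; rewrite ni.
      by right; split=> // Ni'; apply: nC; exists i => //=; rewrite ni.
  - exact: cvg_cst.
  - exact: cvg_pr_tail.
move=> /trivial_sequenceP => /(_ mC) /cvgrPdist_lt /(_ 8^-1).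
have h8 : (0 : R) < 8^-1 by rewrite invr_gt0.
move=> /(_ h8) [n1 _ n1P].
have /cvgrPdist_lt /(_ 8^-1 h8)[n2 _ n2P] := N0.
pose n := maxn n1 n2.
have [j nj Cj] := upper n; have h2 := half n.
have := n1P n (leq_maxl _ _); have := n2P j (leq_trans (leq_maxr _ _) nj).
have ge0 := pr_ge0 mu (N j).
rewrite /= !sub0r !normrN ger0_norm // => Nj.
by rewrite ltr_norml => /andP[_]; nra.
Qed.

(** Bit [n] of the target class is the value that [phi] takes at [n] on the
    larger part of the space. *)
Lemma strongly_ergodic_trivial_hom (phi : Hom_E0 mu (orbit_rel act)) : trivial_hom phi.
Proof.
have : homomorphism mu (orbit_rel act) E0 (hom_val phi) by exact: set_valP phi.
set f := (hom_val phi : X -> E0_space) => -[X0 [mX0 nX0 homf]].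
have mf : measurable_fun setT f by [].
pose A n := [set x | f x n].
have mA n : measurable (A n).
  rewrite (_ : A n = setT `&` f @^-1` [set y : E0_space | y n]); last by rewrite setTI.
  by apply: mf => //; apply: measurable_E0_coord.
pose y : E0_space := fun n => 2^-1 <= pr (A n).
pose N n := [set x | f x n != y n].
have NE n : N n = if y n then ~` A n else A n.
  by apply/seteqP; rewrite /N /A; case: (y n); split=> x /=; case: (f x n).
have mN n : measurable (N n) by rewrite NE; case: (y n) => //; apply: measurableC.
have NY g n : N n `+` act g @` N n = A n `+` act g @` A n.
  rewrite !(act_imageE act_pmp) NE; case: (y n) => //.
  by rewrite preimage_setC !setY_def !setDE !setCK setUC; congr (_ `|` _); rewrite setIC.
have NG g : mu (lim_sup_set (fun n => N n `+` act g @` N n)) = 0%E.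
  have mNY n : measurable (N n `+` act g @` N n).
    by apply: measurableY => //; apply: (measurable_act_image act_pmp).
  apply/negligibleP; first exact: measurable_lim_sup_set.
  apply: (@negligibleS _ _ _ mu (~` X0 `|` act g @` (~` X0))); last first.
    apply: negligibleU; apply/negligibleP.
    - exact: measurableC.
    - exact: nX0.
    - by apply: (measurable_act_image act_pmp); apply: measurableC.
    - apply/pr_eq0P; first by apply: (measurable_act_image act_pmp); apply: measurableC.
      by rewrite (pr_act_image act_pmp) ?/pr ?nX0 //; apply: measurableC.
  move=> x Yx; apply: contrapT => /not_orP[/contrapT X0x].
  rewrite (act_imageE act_pmp) => /contrapT X0gx.
  have [|m fm] := homf _ _ X0gx X0x.
    by exists g; rewrite (actKV act_pmp).
  have [k /= mk Yk] := Yx m I.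
  have : (N k `+` act g @` N k) x by exact: Yk.
  rewrite NY (act_imageE act_pmp) setY_def.
  by rewrite /A /setD /preimage /= fm //; case=> -[].
have N0 : pr (N n) @[n --> \oo] --> 0.
  have /(act_strongly_ergodic.2) : almost_invariant mu act A.
    apply/almost_invariantP => // g.
    under eq_fun do rewrite -NY.
    have mNY n : measurable (N n `+` act g @` N n).
      by apply: measurableY => //; apply: (measurable_act_image act_pmp).
    apply: (@squeeze_cvgr _ _ _ _ (fun=> 0)
      (fun n => pr (\bigcup_(k >= n) (N k `+` act g @` N k)))).
    - apply: nearW => n; rewrite pr_ge0 /=; apply: le_pr => //.
        by apply: bigcup_measurable => ? _.
      by move=> x Nx; exists n => /=.
    - exact: cvg_cst.
    - exact: cvg_pr_tail.
  move=> /trivial_sequenceP => /(_ mA) A0.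
  apply: (@squeeze_cvgr _ _ _ _ (fun=> 0) (fun n => 2 * (pr (A n) * (1 - pr (A n))))).
  - apply: nearW => n; rewrite pr_ge0 /= NE /y.
    have := pr_le1 mu (mA n); have := pr_ge0 mu (A n).
    by case: ifP => [|/negbT]; rewrite -?ltNge ?pr_setC //; nra.
  - exact: cvg_cst.
  - by rewrite -[X in _ --> X](mulr0 2); apply: cvgM => //; apply: cvg_cst.
exists y; exists (lim_sup_set N); split.
- exact: measurable_lim_sup_set.
- exact: strongly_ergodic_lim_sup.
- move=> x /= nE n _; apply: contrapT => nN; apply: nE; exists n => i ni.
  by apply: contrapT => fy; apply: nN; exists i => //=; apply/eqP.
Qed.

End StronglyErgodic.

(** * Asymptotic independence of almost invariant sets *)

Lemma ultra_fmap (T S : Type) (f : T -> S) (U : set_system T) :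
  UltraFilter U -> UltraFilter (f @ U).
Proof.
move=> UU; apply: Build_UltraFilter => G PG fUG; apply/seteqP; split=> // A GA.
have [//|fA] := in_ultra_setVsetC (f @^-1` A) UU.
have : G (A `&` ~` A) by apply: filterI GA _; apply: fUG.
by rewrite setICr => G0; case: (@filter_not_empty _ _ PG).
Qed.

(** Compactness of the unit interval. *)
Lemma ultra_bounded_cvg (R : realType) (T : Type) (U : set_system T) (u : T -> R) :
  UltraFilter U -> (forall n, 0 <= u n <= 1) -> exists l : R, u @ U --> l.
Proof.
move=> UU u01; have UF := ultra_fmap u UU.
have := @segment_compact R 0 1; rewrite compact_ultra => /(_ _ UF).
case=> [|l [_ ul]]; last by exists l.
rewrite /= nbhs_filterE.
have UP : ProperFilter U by apply: ultra_proper.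
by apply: filterE => n; rewrite /= in_itv /= u01.
Qed.

Section InvariantSetFunctions.
Context (R : realType) (d : measure_display) (X : measurableType d).
Context (mu : probability X R) (Gamma : groupType) (act : Gamma -> X -> X).
Hypothesis Gamma_countable : countable [set: Gamma].
Hypothesis act_pmp : pmp_action mu act.
Hypothesis act_ergodic : ergodic mu act.
Local Notation pr := (pr mu).

Section Domination.
Variable L : set X -> R.
Hypothesis L_setU : forall C D, measurable C -> measurable D -> C `&` D = set0 ->
  L (C `|` D) = L C + L D.
Hypothesis L_ge0 : forall C, measurable C -> 0 <= L C.
Hypothesis L_le : forall C, measurable C -> L C <= pr C.

Lemma dominated_null C : measurable C -> pr C = 0 -> L C = 0.
Proof. by move=> mC C0; apply/eqP; rewrite eq_le -[X in _ <= X]C0 L_le // L_ge0. Qed.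

(** A finitely additive function dominated by a finite measure is countably
    additive, since its values on the tails of a disjoint union tend to 0. *)
Lemma dominated_sigma_additive (F : nat -> set X) : (forall i, measurable (F i)) ->
  trivIset setT F -> \sum_(0 <= i < n) L (F i) @[n --> \oo] --> L (\bigcup_n F n).
Proof.
move=> mF tF.
have mU : measurable (\bigcup_n F n) by exact: bigcupT_measurable.
pose S n := \bigcup_(i in [set i | (i < n)%N]) F i.
have mS n : measurable (S n) by apply: bigcup_measurable => ? _.
have SF n : S n `&` F n = set0.
  rewrite -subset0 => x [[i /= ni Fi] Fn].
  by move: (tF i n I I (ex_intro _ x (conj Fi Fn))) ni => ->; rewrite ltnn.
have SS n : S n.+1 = S n `|` F n.
  apply/seteqP; split=> x.
    by move=> [i /=]; rewrite ltnS leq_eqVlt => /orP[/eqP ->|ni] Fi; [right|left; exists i].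
  by move=> [[i /= ni Fi]|Fn]; [exists i => //=; apply: ltnW | exists n => /=].
have sumS (m : set X -> R) : (forall C D, measurable C -> measurable D -> C `&` D = set0 ->
    m (C `|` D) = m C + m D) -> m set0 = 0 -> forall n, \sum_(0 <= i < n) m (F i) = m (S n).
  move=> mD m0; elim=> [|n IH].
    rewrite big_geq // (_ : S 0%N = set0) //.
    by rewrite -subset0 => x [i].
  by rewrite big_nat_recr //= IH SS mD.
have L0 : L set0 = 0 by apply: dominated_null; rewrite ?pr_set0.
have US n : \bigcup_n F n = S n `|` (\bigcup_n F n `\` S n).
  rewrite setDUK //; by move=> x [i _ Fi]; exists i.
have US0 n : S n `&` (\bigcup_n F n `\` S n) = set0 by rewrite setDIK.
have mUS n : measurable (\bigcup_n F n `\` S n) by exact: measurableD.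
have prS : pr (S n) @[n --> \oo] --> pr (\bigcup_n F n).
  have -> : (fun n => pr (S n)) = (fun n => \sum_(0 <= i < n) pr (F i)).
    by apply/funext => n; rewrite (sumS pr (@pr_setU _ _ _ _)) // pr_set0.
  have : (\sum_(0 <= i < n) mu (F i))%E @[n --> \oo] --> mu (\bigcup_n F n).
    exact: measure_semi_sigma_additive.
  rewrite (prE _ mU) (_ : (fun n => _) = (fun n => (\sum_(0 <= i < n) pr (F i))%:E)).
    by move=> /fine_cvgP[].
  by apply/funext => n; rewrite -sumEFin; apply: eq_bigr => i _; rewrite prE.
rewrite (_ : (fun n => _) = (fun n => L (S n))); last first.
  by apply/funext => n; rewrite (sumS L).
apply: (@squeeze_cvgr _ _ _ _
  (fun n => L (\bigcup_n F n) - (pr (\bigcup_n F n) - pr (S n))) (fun=> L (\bigcup_n F n))).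
- apply: nearW => n.
  have h1 := L_ge0 (mUS n); have h2 := L_le (mUS n).
  have h3 : L (\bigcup_n F n) = L (S n) + L (\bigcup_n F n `\` S n).
    by rewrite -L_setU // -US.
  have h4 : pr (\bigcup_n F n) = pr (S n) + pr (\bigcup_n F n `\` S n).
    by rewrite -pr_setU // -US.
  by rewrite h3 h4; apply/andP; split; lra.
- rewrite -[X in _ --> X]subr0; apply: cvgB; first exact: cvg_cst.
  rewrite -[X in _ --> X](subrr (pr (\bigcup_n F n))).
  by apply: cvgB => //; exact: cvg_cst.
- exact: cvg_cst.
Qed.

Hypothesis L_act : forall g C, measurable C -> L (act g @` C) = L C.

(** The saturation [M] of the negative part of a Hahn decomposition of the
    charge [L - L setT * pr] is still negative and is strictly invariant, hence
    null or conull.  So the charge has a constant sign, and its total mass is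
    zero. *)
Lemma invariant_dominated_proportional C : measurable C -> L C = L setT * pr C.
Proof.
move=> mC; have [e eP] := countable_enum Gamma_countable; have [a1 _ _ _] := act_pmp.
pose c := L setT.
pose rho (D : set X) : \bar R := (L D - c * pr D)%:E.
have rho0 : rho set0 = 0%E.
  by rewrite /rho dominated_null ?pr_set0 ?mulr0 ?subrr.
have rho_fin D : measurable D -> rho D \is a fin_num by [].
have rho_sigma : semi_sigma_additive rho.
  move=> F mF tF mU.
  rewrite (_ : (fun n => _) =
    (fun n => (\sum_(0 <= i < n) L (F i) - c * \sum_(0 <= i < n) pr (F i))%:E)).
    apply: cvg_EFin; first by near=> n.
    apply: cvgB; first exact: dominated_sigma_additive.
    apply: cvgM; first exact: cvg_cst.
    have : (\sum_(0 <= i < n) mu (F i))%E @[n --> \oo] --> mu (\bigcup_n F n).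
    exact: measure_semi_sigma_additive.
    rewrite (prE _ mU) (_ : (fun n => _) = (fun n => (\sum_(0 <= i < n) pr (F i))%:E)).
      by move=> /fine_cvgP[].
    by apply/funext => n; rewrite -sumEFin; apply: eq_bigr => i _; rewrite prE.
  apply/funext => n; rewrite mulr_sumr -sumrB -sumEFin.
  by apply: eq_bigr.
pose nu : {charge set X -> \bar R} :=
  HB.pack rho (isCharge.Build d X R rho rho0 rho_fin rho_sigma).
have rhoU D E : measurable D -> measurable E -> D `&` E = set0 ->
    L (D `|` E) - c * pr (D `|` E) = (L D - c * pr D) + (L E - c * pr E).
  by move=> mD mE DE; rewrite L_setU // pr_setU //; lra.
have [P [N [[mP posP] [mN negN] PN _]]] := Hahn_decomposition nu.
pose M := \bigcup_n act (e n) @` N.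
have negM : negative_set nu M.
  apply: bigcup_negative_set => n; split; first exact: measurable_act_image act_pmp _ _ mN.
  move=> D mD DN; have mD' : measurable (act (e n) @^-1` D).
    exact: measurable_act_preimage act_pmp _ _ mD.
  have -> : nu D = nu (act (e n) @^-1` D).
    have -> : act (e n) @^-1` D = act (e n)^-1%g @` D.
      by rewrite (act_imageE act_pmp) invgK.
    by rewrite /= /rho L_act // (pr_act_image act_pmp).
  apply: negN => // x Dx.
  have [y Ny] := DN _ Dx; move=> /(can_inj (actK act_pmp (e n))) <-.
  exact: Ny.
have mM : measurable M by case: negM.
have posCM : positive_set nu (~` M).
  split; first exact: measurableC.
  move=> D mD DM; apply: posP => // x Dx.
  have [n en] := eP 1%g; have : (P `|` N) x by rewrite PN.
  by case=> // Nx; case: (DM _ Dx); exists n => //; exists x => //; rewrite en a1.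
have tot D : measurable D -> (L D - c * pr D) + (L (~` D) - c * pr (~` D)) = 0.
  move=> mD; rewrite -rhoU ?setICr //; last exact: measurableC.
  by rewrite setUCr pr_setT mulr1 subrr.
have vanish D E : measurable D -> measurable E -> pr E = 0 ->
    L D - c * pr D = L (D `\` E) - c * pr (D `\` E).
  move=> mD mE E0; have mDE := measurableI _ _ mD mE; have mDE' := measurableD mD mE.
  have DE0 : pr (D `&` E) = 0.
    by apply/eqP; rewrite eq_le pr_ge0 -[X in _ <= X]E0 le_pr.
  rewrite -{1 2}(setUIDK D E) rhoU //; last by rewrite setDE setIACA setICr setI0.
  by rewrite dominated_null // DE0; lra.
have [M0|M1] := act_ergodic mM (act_image_bigcup_enum act_pmp N eP).
  have pos D : measurable D -> 0 <= L D - c * pr D.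
    move=> mD; rewrite (vanish D M) //; last by apply/pr_eq0P.
    have [_ /(_ (D `\` M))] := posCM; rewrite -lee_fin; apply.
      exact: measurableD.
    by move=> x [].
  rewrite -/c; have := pos _ mC; have := pos _ (measurableC mC); have := tot _ mC; lra.
have CM0 : pr (~` M) = 0 by rewrite pr_setC // /pr M1 subrr.
have neg D : measurable D -> L D - c * pr D <= 0.
  move=> mD; rewrite (vanish D (~` M)) //; last exact: measurableC.
  have [_ /(_ (D `\` ~` M))] := negM; rewrite -lee_fin; apply.
    by apply: measurableD => //; apply: measurableC.
  by move=> x [_ /contrapT].
by rewrite -/c; have := neg _ mC; have := neg _ (measurableC mC); have := tot _ mC; lra.
Unshelve. all: by end_near. Qed.

End Domination.

Lemma non_trivial_often (A : nat -> set X) : almost_invariant mu act A ->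
  ~ trivial_sequence mu A -> exists2 e : R, 0 < e &
    forall N, exists2 n, (N <= n)%N & e <= pr (A n) * (1 - pr (A n)).
Proof.
move=> [mA _] ntA; apply: contrapT => no; apply: ntA; apply/trivial_sequenceP => //.
apply/cvgrPdist_lt => e e0; have [N NP] : exists N, forall n, (N <= n)%N ->
    pr (A n) * (1 - pr (A n)) < e.
  apply: contrapT => /forallNP hN; apply: no; exists e => // N.
  have /existsNP[n /not_implyP[Nn /negP]] := hN N.
  by rewrite -leNgt; exists n.
exists N => // n /= Nn; rewrite sub0r normrN ger0_norm ?NP // mulr_ge0 ?pr_ge0 //.
by rewrite subr_ge0 pr_le1.
Qed.

(** The limit of [pr (A n `&` C)] along an ultrafilter is an invariant set
    function of [C] dominated by the measure, hence proportional to it.  The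
    factor is in the open interval because the ultrafilter is concentrated on
    the indices where [A n] is far from null and conull. *)
Lemma almost_invariant_mixing (A : nat -> set X) : almost_invariant mu act A ->
  ~ trivial_sequence mu A ->
  exists U : set_system nat, exists c : R, [/\ ProperFilter U, \oo `<=` U, 0 < c < 1 &
    forall C, measurable C -> pr (A n `&` C) @[n --> U] --> c * pr C].
Proof.
move=> aiA ntA; have [mA _] := aiA.
have [e e0 often] := non_trivial_often aiA ntA.
pose W := [set n | e <= pr (A n) * (1 - pr (A n))].
have WF : ProperFilter (within W \oo).
  apply: Build_ProperFilter.
  move=> [N _ NP]; have [n Nn Wn] := often N.
  exact: (NP n Nn Wn).
have [U [UU WU]] := ultraFilterLemma WF.
have PU : ProperFilter U by apply: ultra_proper.
have ooU : \oo `<=` U by move=> V ooV; apply: WU; apply: filterS ooV => n Vn _.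
have UW : U W by apply: WU; exists 0%N.
have mAC n C : measurable C -> measurable (A n `&` C) by move=> mC; apply: measurableI.
have exL C : exists l : R, measurable C -> pr (A n `&` C) @[n --> U] --> l.
  have [mC|nC] := pselect (measurable C); last by exists 0.
  have [|l Ul] := ultra_bounded_cvg (u := fun n => pr (A n `&` C)) UU.
    by move=> n; rewrite pr_ge0 pr_le1 //; apply: mAC.
  by exists l.
have [L LP] := choice exL.
have unique (u : nat -> R) (l l' : R) : u @ U --> l -> u @ U --> l' -> l = l'.
  by move=> ul ul'; rewrite -(cvg_lim (@Rhausdorff R) ul) -(cvg_lim (@Rhausdorff R) ul').
have L_setU C D : measurable C -> measurable D -> C `&` D = set0 ->
    L (C `|` D) = L C + L D.
  move=> mC mD CD; apply: unique (LP _ (measurableU _ _ mC mD)) _.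
  rewrite (_ : (fun n => _) = (fun n => pr (A n `&` C) + pr (A n `&` D))).
    by apply: cvgD; apply: LP.
  apply/funext => n; rewrite setIUr pr_setU //; try exact: mAC.
  by rewrite setIACA CD setI0.
have L_ge0 C : measurable C -> 0 <= L C.
  move=> /LP LC; apply: (cvgr_to_ge LC); apply: filterE => n; exact: pr_ge0.
have L_le C : measurable C -> L C <= pr C.
  move=> mC; apply: (cvgr_to_le (LP _ mC)); apply: filterE => n; apply: le_pr => //.
  exact: mAC.
have L_act g C : measurable C -> L (act g @` C) = L C.
  move=> mC; have mgC := measurable_act_image act_pmp g mC.
  apply: unique (LP _ mgC) _; rewrite -[L C]addr0.
  rewrite (_ : (fun n => _) = (fun n => pr (A n `&` C) +
      (pr (A n `&` act g @` C) - pr (A n `&` C)))); last first.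
    by apply/funext => n; rewrite addrC subrK.
  apply: cvgD; first exact: LP.
  apply: (@norm_cvg0 _ R^o).
  have [_ /(_ g^-1%g) /cvg_mu_prP] := aiA.
  have mgA n := measurable_act_image act_pmp g^-1%g (mA n).
  move=> /(_ (fun n => measurableY (mA n) (mgA n))) A0.
  apply: (@squeeze_cvgr _ _ _ _ (fun=> 0) (fun n => pr (A n `+` act g^-1%g @` A n))).
  - apply: filterE => n; rewrite normr_ge0 /=.
    (* Moving [C] by [g] amounts to moving [A n] by the inverse, which hardly changes it. *)
    have -> : pr (A n `&` act g @` C) = pr (act g^-1%g @` A n `&` C).
      rewrite -(pr_act_preimage act_pmp g); last exact: mAC.
      rewrite preimage_setI !(act_imageE act_pmp) invgK.
      congr (pr (_ `&` _)); apply/seteqP; split=> x; by rewrite /preimage /= (actK act_pmp).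
    apply: le_trans (ler_dist_pr _ _ _) _; try by apply: measurableI.
    apply: le_pr; try by apply: measurableY => //; apply: measurableI.
    by rewrite -setIYl setYC; apply: subIsetl.
  - exact: cvg_cst.
  - by apply: cvg_trans A0; apply: cvg_app; exact: ooU.
exists U, (L setT); split=> //; last first.
  move=> C mC; rewrite -(invariant_dominated_proportional L_setU L_ge0 L_le L_act mC).
  exact: LP.
have LT : pr (A n) @[n --> U] --> L setT.
  by have := LP _ measurableT; under eq_fun do rewrite setIT.
have c0 := L_ge0 _ measurableT; have := L_le _ measurableT; rewrite pr_setT => c1.
have : e <= L setT * (1 - L setT).
  have cvgp : pr (A n) * (1 - pr (A n)) @[n --> U] --> L setT * (1 - L setT).
    by apply: cvgM => //; apply: cvgB => //; exact: cvg_cst.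
  exact: (cvgr_to_ge cvgp).
by move=> ec; apply/andP; split; nra.
Qed.

End InvariantSetFunctions.

(** * Thin chains of nearly invariant sets *)

Lemma filter_seq (T I : choiceType) (U : set_system T) (s : seq I) (P : I -> set T) :
  Filter U -> (forall i, i \in s -> U (P i)) -> U [set n | forall i, i \in s -> P i n].
Proof.
move=> FU; elim: s => [|i s IH] UP; first exact: filterE.
apply: filterS2 (UP i (mem_head _ _)) (IH _) => [n Pi Ps j|j js].
  by rewrite inE => /orP[/eqP ->|/Ps].
by apply: UP; rewrite inE js orbT.
Qed.

Section ThinChains.
Context (R : realType) (d : measure_display) (X : measurableType d).
Context (mu : probability X R) (Gamma : groupType) (act : Gamma -> X -> X).
Hypothesis act_pmp : pmp_action mu act.
Local Notation pr := (pr mu).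

Definition thin_chain (F : seq Gamma) (e t : R) (B : nat -> set X) (M : nat) : Prop :=
  [/\ forall m, measurable (B m), B 0%N = set0,
      forall m, (M <= m)%N -> B m = setT, forall m, B m `<=` B m.+1 &
      (forall m, pr (B m.+1 `\` B m) <= t) /\
      (forall m g, g \in F -> pr (B m `+` act g @` B m) <= e)].

(** Every step of the chain is cut in two by [D].  The new sets are built from
    two sets of the chain and [D], so the three errors of invariance add
    up. *)
Lemma thin_chain_refine F e t t' B M D : thin_chain F (e / 3) t B M -> measurable D ->
  (forall g, g \in F -> pr (D `+` act g @` D) <= e / 3) ->
  (forall m, (m < M)%N -> pr ((B m.+1 `\` B m) `&` D) <= t') ->
  (forall m, (m < M)%N -> pr ((B m.+1 `\` B m) `\` D) <= t') -> 0 <= t' ->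
  thin_chain F e t'
    (fun m => B m./2 `|` (if odd m then B m./2.+1 `&` D else set0)) M.*2.
Proof.
move=> [mB B0 BT BS [Bt Be]] mD De DI DD t0.
have mg := measurable_act_image act_pmp.
have step m : pr ((B m.+1 `\` B m) `&` D) <= t' /\ pr ((B m.+1 `\` B m) `\` D) <= t'.
  have [mM|Mm] := ltnP m M; first by split; [exact: DI|exact: DD].
  by rewrite !BT ?setDv ?set0I ?set0D ?pr_set0 //; apply: leq_trans Mm _.
have e0 g : g \in F -> 0 <= e.
  by move=> /De h; have := pr_ge0 mu (D `+` act g @` D); lra.
split.
- move=> m; apply: measurableU => //; case: ifP => // _; exact: measurableI.
- by rewrite /= B0 setU0.
- move=> m Mm; rewrite BT ?setTU //.
  by rewrite -(doubleK M) half_leq.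
- move=> m; rewrite /= uphalf_half; case: (odd m) => /=; last by rewrite add0n setU0; exact: subsetUl.
  by rewrite add1n setU0 subUset; split=> // x [].
- split=> m /=.
    have [h1 h2] := step m./2.
    rewrite uphalf_half; case: (odd m) => /=; rewrite ?add1n ?add0n !setU0.
      apply: le_trans h2; apply: le_pr.
      + by apply: measurableD => //; apply: measurableU => //; apply: measurableI.
      + by apply: measurableD => //; apply: measurableD.
      + by move=> x [Bx /not_orP[nBx nD]]; split; [split|move=> Dx; apply: nD].
    apply: le_trans h1; apply: le_pr.
    + by apply: measurableD => //; apply: measurableU => //; apply: measurableI.
    + by apply: measurableI => //; apply: measurableD.
    + by move=> x [[//|[Bx Dx]] nBx].
  move=> g gF; have e0' := e0 g gF; case: (odd m); last first.
    by rewrite setU0; apply: le_trans (Be _ _ gF) _; lra.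
  set A := B m./2; set C := B m./2.+1.
  have mA : measurable A by exact: mB.
  have mC : measurable C by exact: mB.
  have mE : measurable (A `|` C `&` D) by apply: measurableU => //; apply: measurableI.
  apply: le_trans (_ : pr ((A `+` act g @` A) `|` ((C `+` act g @` C) `|` (D `+` act g @` D))) <= _).
    apply: le_pr.
    + by apply: measurableY => //; apply: mg.
    + by apply: measurableU; [|apply: measurableU]; apply: measurableY => //; apply: mg.
    + rewrite !(act_imageE act_pmp) !setY_def /preimage /setU /setD /setI => x /=.
      have [C1|C1] := pselect (C x); have [C2|C2] := pselect (C (act g^-1%g x)); tauto.
  have mAg : measurable (A `+` act g @` A) by apply: measurableY => //; apply: mg.
  have mCg : measurable (C `+` act g @` C) by apply: measurableY => //; apply: mg.
  have mDg : measurable (D `+` act g @` D) by apply: measurableY => //; apply: mg.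
  apply: le_trans (le_pr_setU _ mAg (measurableU _ _ mCg mDg)) _.
  have := le_pr_setU mu mCg mDg; have := De g gF.
  have := Be m./2 g gF; have := Be m./2.+1 g gF.
  by rewrite -/A -/C; lra.
Qed.

Hypothesis Gamma_countable : countable [set: Gamma].
Hypothesis act_ergodic : ergodic mu act.

(** Cutting with a set that is nearly independent of all steps multiplies their
    measures by at most [r]; this number is larger than [c] and [1 - c], which
    leaves room for the approximation. *)
Lemma thin_chain_exists A : almost_invariant mu act A -> ~ trivial_sequence mu A ->
  forall F e t, 0 < e -> 0 < t -> exists B M, thin_chain F e t B M.
Proof.
move=> aiA ntA F e t e0 t0; have [mA _] := aiA.
have [U [c [PU ooU /andP[c0 c1] mix]]] :=
  almost_invariant_mixing Gamma_countable act_pmp act_ergodic aiA ntA.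
pose r := 1 - c * (1 - c).
have r0 : 0 < r by rewrite /r; nra.
have r1 : r < 1 by rewrite /r; nra.
have rk k : 0 < r ^+ k by exact: exprn_gt0.
suff chain k : forall e, 0 < e -> exists B M, thin_chain F e (r ^+ k) B M.
  have [k rkt] : exists k, r ^+ k <= t.
    have /cvgrPdist_lt/(_ t t0)[k _ /(_ k (leqnn k))] : r ^+ n @[n --> \oo] --> (0 : R).
      by apply: cvg_expr; rewrite ger0_norm // ltW.
    by rewrite /= sub0r normrN ger0_norm ?(ltW (rk k)) // => /ltW; exists k.
  have [B [M [mB B0 BT BS [Bt Be]]]] := chain k e e0.
  by exists B, M; split=> //; split=> // m; apply: le_trans (Bt m) rkt.
elim: k => [|k IH] {e0}e e0.
  exists (fun m => if m is 0%N then set0 else setT), 1%N; split=> //; first by case.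
  - by case.
  - split; first by case=> [|m]; rewrite expr0 pr_le1 //; apply: measurableD.
    move=> m g _; rewrite (act_imageE act_pmp) (_ : _ `+` _ = set0) ?pr_set0 ?(ltW e0) //.
    by case: m => [|m]; rewrite ?preimage_set0 ?preimage_setT setYK.
have [|B [M chB]] := IH (e / 3); first by lra.
have [mB B0 BT BS [Bt Be]] := chB.
pose S m := B m.+1 `\` B m.
have mS m : measurable (S m) by apply: measurableD.
have inv : U [set n | forall g, g \in F -> pr (A n `+` act g @` A n) <= e / 3].
  apply: filter_seq => g _; apply: ooU.
  have [_ /(_ g) /cvg_mu_prP] := aiA.
  move=> /(_ (fun n => measurableY (mA n) (measurable_act_image act_pmp g (mA n)))).
  have e3 : 0 < e / 3 by lra.
  move=> /cvgrPdist_lt/(_ _ e3); apply: filterS => n.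
  by rewrite /= sub0r normrN ger0_norm ?pr_ge0 // => /ltW.
have kr : c * r ^+ k < r ^+ k.+1 /\ (1 - c) * r ^+ k < r ^+ k.+1.
  by rewrite exprS !ltr_pM2r ?rk // /r; split; nra.
have cS m : c * pr (S m) < r ^+ k.+1 /\ pr (S m) - c * pr (S m) < r ^+ k.+1.
  have := Bt m; have := pr_ge0 mu (S m); move: kr; rewrite -/(S m) => -[k1 k2] s0 sk.
  split; first by apply: le_lt_trans k1; rewrite ler_pM2l.
  by apply: le_lt_trans k2; nra.
have small1 m : U [set n | pr (S m `&` A n) <= r ^+ k.+1].
  have h : pr (S m `&` A n) @[n --> U] --> c * pr (S m).
    by under eq_fun do rewrite setIC; exact: mix.
  exact: (cvgr_le _ h _ (cS m).1).
have small2 m : U [set n | pr (S m `\` A n) <= r ^+ k.+1].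
  have : pr (S m `\` A n) @[n --> U] --> pr (S m) - c * pr (S m).
    rewrite (_ : (fun n => _) = (fun n => pr (S m) - pr (A n `&` S m))).
      by apply: cvgB; [exact: cvg_cst | exact: mix].
    by apply/funext => n; rewrite (pr_setID mu (mS m) (mA n)) setIC; lra.
  by move=> h; exact: (cvgr_le _ h _ (cS m).2).
have /filter_ex[n [[invn s1] s2]] : U ([set n | forall g, g \in F -> pr (A n `+` act g @` A n) <= e / 3]
    `&` [set n | forall m, m \in iota 0 M -> pr (S m `&` A n) <= r ^+ k.+1]
    `&` [set n | forall m, m \in iota 0 M -> pr (S m `\` A n) <= r ^+ k.+1]).
  apply: filterI; last by apply: filter_seq => m _; exact: small2.
  by apply: filterI => //; apply: filter_seq => m _; exact: small1.
exists (fun m => B m./2 `|` (if odd m then B m./2.+1 `&` A n else set0)), M.*2.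
apply: thin_chain_refine chB (mA n) invn _ _ (ltW (rk _)) => m mM.
  by apply: s1; rewrite mem_iota.
by apply: s2; rewrite mem_iota.
Qed.

End ThinChains.

(** * Borel families of homomorphisms *)

(** The Borel structure of the Baire space, presented by coordinates so that
    joint measurability is easy to check. *)
Definition baire_space := g_sigma_algebraType
  [set S : set (nat -> nat) | exists k m, S = [set z | z k = m]].

Lemma measurable_baire_coord k m : measurable [set z : baire_space | z k = m].
Proof. by apply: sub_sigma_algebra; exists k, m. Qed.

Lemma measurable_baire_property (A : set baire_space) :
  measurable A -> baire_property cylinders A.
Proof.
suff : measurable `<=` [set B : set baire_space | baire_property cylinders B] by exact.
apply: smallest_sub.
  split=> [|B bB|F bF].
  - move=> c; exists c => //; left; apply: nwd_meager => a; exists a => //.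
    by rewrite set0I setI0.
  - by rewrite setTD; exact: baire_property_setC.
  - exact: baire_property_bigcup.
move=> _ [k [m ->]] c; have [z cz] := box_neq0 cylindersP c.
exists (mkseq z (maxn (size c) k.+1)); first by apply: box_mkseq_sub cz _; rewrite leq_maxl.
have zk w : box cylinders (mkseq z (maxn (size c) k.+1)) w -> w k = z k.
  by move=> /box_mkseqE[-> //]; rewrite leq_max ltnSn orbT.
have [zm|zm] := eqVneq (z k) m; [right|left]; apply: nwd_meager => a; exists a => //;
  rewrite -subset0 => w [_ []] /=.
- by move=> /zk ->; rewrite zm.
- by move=> wm /zk zw; move: zm; rewrite -zw wm eqxx.
Qed.

Section Homs.
Context (R : realType) (d : measure_display) (X : measurableType d).
Context (mu : probability X R).
Local Notation pr := (pr mu).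

Lemma borel_cantelli_half (F : nat -> set X) n0 : (forall k, measurable (F k)) ->
  (forall k, (n0 <= k)%N -> pr (F k) <= 1 / (2 ^ k.+1)%:R) -> mu (lim_sup_set F) = 0%E.
Proof.
move=> mF Fle; pose G k := if (n0 <= k)%N then F k else set0.
have mG k : measurable (G k) by rewrite /G; case: ifP.
have G0 : mu (lim_sup_set G) = 0%E.
  apply: lim_sup_set_cvg0 => //; apply: le_lt_trans (ltry 1).
  apply: le_trans (epsilon_trick0 xpredT (@ler01 R)).
  have Gle k : (mu (G k) <= (1 / (2 ^ k.+1)%:R)%:E)%E.
    rewrite prE // lee_fin /G.
    by case: ifP => [/Fle//|_]; rewrite pr_set0 divr_ge0.
  by apply: lee_nneseries => // k _; exact: Gle.
apply/negligibleP; first exact: measurable_lim_sup_set.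
apply: (@negligibleS _ _ _ mu (lim_sup_set G)); last first.
  by apply/negligibleP => //; exact: measurable_lim_sup_set.
move=> x Fx n _; have [k /= nk Fk] := Fx (maxn n n0) I.
move: nk; rewrite geq_max => /andP[nk n0k].
by exists k => //; rewrite /G n0k.
Qed.

Lemma mu_eq_ae (A B : set X) : measurable A -> measurable B ->
  {ae mu, forall x, A x <-> B x} -> mu A = mu B.
Proof.
move=> mA mB [N [mN N0 AB]]; have mY := measurableY mA mB.
have Y0 : pr (A `+` B) = 0.
  apply: pr_null N0 => // x; rewrite setY_def => ABx; apply: AB => -[AB BA].
  by case: ABx => -[h1 h2]; [exact: h2 (AB h1)|exact: h2 (BA h1)].
have := ler_dist_pr mu mA mB; rewrite Y0 normr_le0 subr_eq0 => /eqP prAB.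
by rewrite !prE // prAB.
Qed.

Definition mfun_class (f : X -> E0_space) (mf : measurable_fun setT f) :
    {mfun_ mu, X >-> E0_space} :=
  (\pi_({mfun_ mu, X >-> E0_space}) (mfun_Sub (mem_set mf) : {mfun X >-> E0_space}))%qT.

Lemma mfun_class_ae f (mf : measurable_fun setT f) :
  {ae mu, forall x, mfun_class mf x = f x}.
Proof.
have /eqmodP/asboolP : (repr (mfun_class mf) = mfun_Sub (mem_set mf)
    %[mod {mfun_ mu, X >-> E0_space}])%qT by rewrite reprK.
by apply: filterS => x /(_ I).
Qed.

Variable E : X -> X -> Prop.

Lemma homomorphism_ae (f g : X -> E0_space) : {ae mu, forall x, g x = f x} ->
  homomorphism mu E E0 f -> homomorphism mu E E0 g.
Proof.
move=> [N [mN N0 Ngf]] [X0 [mX0 X00 homf]]; exists (X0 `&` ~` N).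
have gf x : ~ N x -> g x = f x by move=> nN; apply: contrapT => h; apply/nN/Ngf.
split; first by apply: measurableI => //; exact: measurableC.
  rewrite setCI setCK; apply/negligibleP.
    by apply: measurableU => //; apply: measurableC.
  by apply: negligibleU; apply/negligibleP => //; apply: measurableC.
by move=> x y [X0x Nx] [X0y Ny] Exy; rewrite !gf //; apply: homf.
Qed.

Section Family.
Variable (f : baire_space -> X -> E0_space).
Hypothesis mf : forall n, measurable [set zx : baire_space * X | f zx.1 zx.2 n].
Hypothesis homf : forall z, homomorphism mu E E0 (f z).

Let mf2 : measurable_fun setT (fun zx : baire_space * X => f zx.1 zx.2).
Proof. exact: measurable_fun_E0_space. Qed.

Let mf1 z : measurable_fun setT (f z).
Proof.
exact: (measurableT_comp mf2 (measurable_fun_pair (measurable_cst z) (@measurable_id _ _ setT))).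
Qed.

Definition hom_family (z : baire_space) : Hom_E0_space mu E :=
  exist _ (mfun_class (mf1 z))
    (mem_set (homomorphism_ae (mfun_class_ae (mf1 z)) (homf z)) :
       mfun_class (mf1 z) \in hom_set E E0).

Lemma hom_family_ae z : {ae mu, forall x, hom_val (hom_family z) x = f z x}.
Proof. exact: mfun_class_ae. Qed.

(** The generators of the target evaluate the measure of [A] intersected with a
    preimage of [B], so this is the measurability of the measures of the
    sections of a measurable subset of the product. *)
Lemma measurable_hom_family : measurable_fun setT hom_family.
Proof.
pose h : baire_space -> mfun_space mu E0_space := fun z => hom_val (hom_family z).
have mh : measurable_fun setT h.
  apply: (@measurability _ _ baire_space (mfun_space mu E0_space) setT h
    (@mfun_generators R d X mu _ E0_space) erefl).
  move=> _ [_ [A [B [mA mB [V mV <-]]]] <-].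
  rewrite setTI setTI.
  have mAB z : measurable (A `&` f z @^-1` B).
    by apply: measurableI => //; rewrite -[X in measurable X]setTI; apply: mf1.
  have -> : (fun z => hom_val (hom_family z)) @^-1`
      ((fun h : {mfun_ mu, X >-> E0_space} => mu (A `&` h @^-1` B)) @^-1` V) =
      (mu \o xsection (setT `*` A `&`
        (fun zx : baire_space * X => f zx.1 zx.2) @^-1` B)) @^-1` V.
    apply/funext => z; rewrite /preimage /=; congr (V _).
    have -> : xsection (setT `*` A `&` [set zx : baire_space * X | B (f zx.1 zx.2)]) z =
        A `&` f z @^-1` B.
      by apply/seteqP; split=> x; rewrite xsectionE /=; [move=> [[_ ?] ?]|move=> [? ?]].
    apply: mu_eq_ae => //.
      by apply: measurableI => //; rewrite -[X in measurable X]setTI; apply: measurable_funPT.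
    have := hom_family_ae z; apply: filterS => x; rewrite /hom_val /preimage /= => hx.
    by rewrite /h /hom_val /= /setI /= hx.
  rewrite -[X in measurable X]setTI; apply: measurable_fun_xsection => //.
  apply: measurableI; first exact: measurableX.
  by rewrite -[X in measurable X]setTI; apply: mf2.
move=> _ S [S0 mS0 <-]; rewrite setTI setTI.
by have := mh measurableT S0 mS0; rewrite setTI.
Qed.

End Family.
End Homs.

(** * Non-classifiability *)

Lemma meager_involution (s : nat -> nat -> nat) M : (forall k, involutive (s k)) ->
  meager cylinders M -> meager cylinders [set x | M (fun k => s k (x k))].
Proof.
move=> sK [N nN MN]; exists (fun n => [set x | N n (fun k => s k (x k))]); last first.
  by move=> x /MN[n _ Nx]; exists n.
move=> n c; have [x cx] := box_neq0 cylindersP c.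
have [d dc dN] := nN n (mkseq (fun k => s k (x k)) (size c)).
have [w dw] := box_neq0 cylindersP d; have /box_mkseqE[wx _] := dc _ dw.
exists (mkseq (fun k => s k (w k)) (maxn (size c) (size d))).
  move=> y /box_mkseqE[yw _]; apply: (boxE cx) => // i ic.
  by rewrite yw ?wx ?sK // leq_max ic.
rewrite -subset0 => y [/box_mkseqE[yw _] Ny].
suff : (box cylinders d `&` N n) (fun k => s k (y k)) by rewrite dN.
split=> //; apply: (boxE dw) => // i id.
by rewrite yw ?sK // leq_max id orbT.
Qed.

Lemma meager_eventually_neq0 :
  meager cylinders [set x | exists n, forall k, (n <= k)%N -> x k != 0%N].
Proof.
apply: (@sub_meager _ _ _ (\bigcup_n [set x | forall k, (n <= k)%N -> x k != 0%N])).
  by move=> x [n xn]; exists n.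
apply: meager_bigcup => n; apply: nwd_meager => c.
have [x cx] := box_neq0 cylindersP c.
pose m := maxn n (size c).
pose y k := if (k < m)%N then x k else 0%N.
have cy : box cylinders c y.
  by apply: (boxE cx) => // i ic; rewrite /y leq_max ic orbT.
exists (mkseq y m.+1); first by apply: box_mkseq_sub cy _; rewrite leqW // leq_maxr.
rewrite -subset0 => z [/box_mkseqE[zy _] /(_ m (leq_maxl _ _))].
by rewrite zy // /y ltnn.
Qed.

Section NotClassifiable.
Context (R : realType) (d : measure_display) (X : measurableType d).
Context (mu : probability X R) (Gamma : groupType) (act : Gamma -> X -> X).
Hypothesis Gamma_countable : countable [set: Gamma].
Hypothesis act_pmp : pmp_action mu act.
Hypothesis act_ergodic : ergodic mu act.
Local Notation pr := (pr mu).

(** Under a reduction to isomorphism, generic points of the Baire space would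
    have equivalent homomorphisms.  But a generic [x] vanishes infinitely
    often, and at these places the bits of [x] and of its image under [swap],
    which exchanges 0 and [M k] at [k] and preserves genericity, differ
    everywhere. *)
Lemma not_classifiable : ~ strongly_ergodic mu act ->
  ~ classifiable_by_countable_structures (@hom_equiv R d X mu (orbit_rel act)).
Proof.
move=> nse [L [f [mf fP]]].
have [A [aiA ntA]] : exists A, almost_invariant mu act A /\ ~ trivial_sequence mu A.
  apply: contrapT => no; apply: nse; split=> // A aiA.
  by apply: contrapT => ntA; apply: no; exists A.
have [e eP] := countable_enum Gamma_countable.
have chains k : exists BM : (nat -> set X) * nat,
    thin_chain mu act (map e (iota 0 k)) (1 / (2 ^ k.+1)%:R) (1 / (2 ^ k.+1)%:R) BM.1 BM.2.
  have k0 : (0 : R) < 1 / (2 ^ k.+1)%:R by rewrite divr_gt0 // ltr0n expn_gt0.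
  have [B [M BM]] := thin_chain_exists act_pmp Gamma_countable act_ergodic aiA ntA
    (map e (iota 0 k)) k0 k0.
  by exists (B, M).
have {chains}[BM BMP] := choice chains.
pose B k := (BM k).1; pose M k := (BM k).2.
have mB k m : measurable (B k m) by have [h _ _ _ _] := BMP k; exact: h.
have B0 k : B k 0%N = set0 by have [_ h _ _ _] := BMP k; exact: h.
have BM1 k : B k (M k) = setT by have [_ _ BT _ _] := BMP k; apply: BT.
have Bstep k m : pr (B k m `+` B k m.+1) <= 1 / (2 ^ k.+1)%:R.
  have [_ _ _ BS [Bt _]] := BMP k.
  rewrite setY_def (_ : _ `\` _ = set0) ?set0U; first exact: Bt.
  by rewrite setD_eq0; exact: BS.
have Binv k i m : (i < k)%N -> pr (B k m `+` act (e i) @` B k m) <= 1 / (2 ^ k.+1)%:R.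
  have [_ _ _ _ [_ Be]] := BMP k; move=> ik; apply: Be.
  by apply: map_f; rewrite mem_iota.
pose phi (z : baire_space) (u : X) : E0_space := fun k => `[< B k (z k) u >].
have mphi n : measurable [set zx : baire_space * X | phi zx.1 zx.2 n].
  rewrite (_ : mkset _ = \bigcup_m ([set z : baire_space | z n = m] `*` B n m)).
    by apply: bigcupT_measurable => m; apply: measurableX => //; exact: measurable_baire_coord.
  apply/seteqP; split=> [[z u] /asboolP Bu|[z u] [m _ [/= zm Bu]]].
    by exists (z n).
  by apply/asboolP; rewrite /= zm.
have homphi z : homomorphism mu (orbit_rel act) E0 (phi z).
  pose bad i := lim_sup_set (fun k => B k (z k) `+` act (e i) @` B k (z k)).
  have mY i k : measurable (B k (z k) `+` act (e i) @` B k (z k)).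
    by apply: measurableY => //; apply: (measurable_act_image act_pmp).
  have mbad i : measurable (bad i) by exact: measurable_lim_sup_set.
  have mU : measurable (\bigcup_i bad i) by exact: bigcupT_measurable.
  exists (~` (\bigcup_i bad i)); split; first exact: measurableC.
    rewrite setCK; apply/negligibleP => //; apply: negligible_bigcup => i.
    apply/negligibleP => //; apply: (@borel_cantelli_half _ _ _ _ _ i.+1) => // k ik.
    exact: Binv.
  move=> x y _ ny [g yE]; have [i eg] := eP g.
  have : ~ bad i y by move=> b; apply: ny; exists i.
  move=> /existsNP[n /not_implyP[_ nY]]; exists n => k nk.
  have : ~ (B k (z k) `+` act (e i) @` B k (z k)) y by move=> Yy; apply: nY; exists k.
  rewrite setY_def (act_imageE act_pmp) /setD /setU /preimage /= yE eg (actK act_pmp).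
  move=> h; apply: asbool_equiv_eq; split=> h1; apply: contrapT => h2; apply: h; by [left|right].
pose psi := hom_family mphi homphi.
have psiE z w : hom_equiv (psi z) (psi w) <-> {ae mu, forall u, E0 (phi z u) (phi w u)}.
  have ez := hom_family_ae mphi homphi z; have ew := hom_family_ae mphi homphi w.
  by split; apply: filterS3 ez ew => u; rewrite /psi => -> ->.
pose T (z : nat -> nat) k s := relations (f (psi z)) k s.
have baire_T k s : baire_property cylinders [set z | T z k s].
  apply: measurable_baire_property.
  have mpsi := measurable_hom_family mphi homphi.
  have := measurableT_comp mf mpsi.
  move=> /(_ measurableT _ (measurable_relations k s)); rewrite setTI; exact.
have hom_T x y : (exists n, forall i, (n <= i)%N -> adj (x i) (y i)) ->
    exists g, iso (T x) (T y) g.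
  move=> [n xy]; apply/structure_isoP; apply/fP/psiE.
  have mY k : measurable (B k (x k) `+` B k (y k)) by exact: measurableY.
  exists (lim_sup_set (fun k => B k (x k) `+` B k (y k))); split.
  - exact: measurable_lim_sup_set.
  - apply: (@borel_cantelli_half _ _ _ _ _ n) => // k /xy.
    have [->|xyk] := eqVneq (x k) (y k).
      by rewrite setYK pr_set0 divr_ge0.
    have [ltxy|ltyx|/eqP] := ltngtP (x k) (y k); last by rewrite (negbTE xyk).
      move=> /andP[_ yx]; have -> : y k = (x k).+1 by apply/eqP; rewrite eqn_leq yx.
      exact: Bstep.
    move=> /andP[xy' _]; have -> : x k = (y k).+1 by apply/eqP; rewrite eqn_leq xy'.
    by rewrite setYC; exact: Bstep.
  - move=> u /= nE m _; apply: contrapT => nY; apply: nE; exists m => k mk.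
    have {}nY : ~ (B k (x k) `+` B k (y k)) u by move=> Yu; apply: nY; exists k.
    move: nY; rewrite setY_def => h; apply: asbool_equiv_eq.
    by split=> h1; apply: contrapT => h2; apply: h; [left|right].
have [Mg mMg gen] := generic_ergodicity baire_T hom_T.
pose swap k a := if a == 0%N then M k else if a == M k then 0%N else a.
have swapK k : involutive (swap k).
  move=> a; rewrite /swap; case: (eqVneq a 0%N) => [->|a0].
    by case: (eqVneq (M k) 0%N) => [->|]; rewrite ?eqxx.
  case: (eqVneq a (M k)) => [->|aM]; first by rewrite eqxx.
  by rewrite (negbTE a0) (negbTE aM).
have [x [nMx nMsx often]] : exists x, [/\ ~ Mg x, ~ Mg (fun k => swap k (x k)) &
    ~ exists n, forall k, (n <= k)%N -> x k != 0%N].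
  apply: contrapT => no; apply: (box_nonmeager cylindersP (c := [::])).
  apply: sub_meager (meagerU mMg (meagerU (meager_involution swapK mMg)
    meager_eventually_neq0)) => x _.
  by apply: contrapT => /not_orP[? /not_orP[? ?]]; apply: no; exists x.
have /structure_isoP/fP/psiE[N [mN N0 NP]] := gen _ _ nMx nMsx.
have [u Nu] : exists u, ~ N u.
  apply: contrapT => /forallNP allN.
  have : mu N = 1%E.
    rewrite -(@probability_setT _ _ _ mu); congr (mu _); apply/seteqP; split=> // u _.
    by apply: contrapT; exact: allN.
  by rewrite N0 => -[] /eqP; rewrite eq_sym oner_eq0.
have [n xn] : E0 (phi x u) (phi (fun k => swap k (x k)) u).
  by apply: contrapT => h; apply/Nu/NP.
apply: often; exists n => k nk; apply/eqP => xk0.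
have := xn k nk; rewrite /phi xk0 /swap eqxx B0 BM1 asboolF // asboolT //.
Qed.

End NotClassifiable.

Unset Implicit Arguments.

Theorem corollary0p2 (R : realType) (d : measure_display)
    (X : measurableType d) (mu : probability X R)
    (Gamma : groupType) (act : Gamma -> X -> X) :
  countable [set: Gamma] ->
  standard_borel R X ->
  pmp_action mu act ->
  ergodic mu act ->
  (strongly_ergodic mu act ->
     forall phi : Hom_E0 mu (orbit_rel act), trivial_hom phi) /\
  (~ strongly_ergodic mu act ->
     ~ classifiable_by_countable_structures
         (@hom_equiv R d X mu (orbit_rel act))).
Proof.
move=> Gamma_countable _ act_pmp act_ergodic; split=> [sterg phi|].
  exact: (strongly_ergodic_trivial_hom Gamma_countable act_pmp sterg).
exact: (not_classifiable Gamma_countable act_pmp act_ergodic).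
Qed.
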